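(* The chase of a rule set $\mathcal{R}$ terminates if the chase of some TGD set in $\mathsf{Sing}(\mathcal{R})$ terminates.
   Context: Rules are function- and constant-free first-order formulas of two kinds: tuple generating dependencies (TGDs) $\forall \vec{x},\vec{y}.(\beta[\vec{x},\vec{y}] \to \exists \vec{w}.\eta[\vec{x},\vec{w}])$ and equality generating dependencies (EGDs) $\forall \vec{x}.(\beta[\vec{x}] \to x \approx y)$ with $x,y \in \vec{x}$, where $\beta,\eta$ are non-empty conjunctions of equality-free atoms. The (non-oblivious, Skolem) chase on an ontology $\langle\mathcal{R},\mathcal{F}\rangle$ starts from the fact set $\mathcal{F}$; a TGD with body match $\sigma$ is applicable if no extension of $\sigma$ maps its head into the current set and then adds its head with existential variables $w$ replaced by Skolem terms $f_w(\sigma(\vec{x}))$; an EGD with body match $\sigma$ and $\sigma(x)\neq\sigma(y)$ merges the two terms (deeper into shallower by a fixed total order compatible with depth). Chase sequences must be fair. The chase of a rule set $\mathcal{R}$ terminates if for every fact set $\mathcal{F}$ all chase sequences of $\langle\mathcal{R},\mathcal{F}\rangle$ are finite. A singularisation of a conjunction of atoms $\beta$ is obtained by choosing, for each variable $x$ of $\beta$, one of its occurrences to keep, replacing every other ($i$-th) occurrence of $x$ by a fresh variable $x_i$, and adding the atom $\mathsf{EQ}(x,x_i)$ for each such fresh variable, where $\mathsf{EQ}$ is a fresh binary predicate. A singularisation of a TGD $\beta\to\exists\vec{w}.\eta$ is $\beta'\to\exists\vec{w}.\eta$ and of an EGD $\beta\to x\approx y$ is $\beta'\to\mathsf{EQ}(x,y)$,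 with $\beta'$ a singularisation of $\beta$. $\mathsf{Sing}(\mathcal{R})$ is the set of all TGD sets containing exactly one singularisation of each rule of $\mathcal{R}$, together with the reflexivity rules $P(x_1,\ldots,x_n)\to\bigwedge_i\mathsf{EQ}(x_i,x_i)$ for every predicate $P\neq\approx$ of $\mathcal{R}$, symmetry $\mathsf{EQ}(x,y)\to\mathsf{EQ}(y,x)$, and transitivity $\mathsf{EQ}(x,y)\wedge\mathsf{EQ}(y,z)\to\mathsf{EQ}(x,z)$. *)

(* Defs.v *)
From HB Require Import structures.
From mathcomp Require Import all_boot.
From mathcomp Require Import finmap.

Set Implicit Arguments.
Unset Strict Implicit.
Unset Printing Implicit Defensive.

Local Open Scope fset_scope.

(* Variables and constants are numbered. A predicate symbol is a pair
   (name, arity), so there are infinitely many symbols of every arity. The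
   equality symbol is not one of them: atoms are equality-free, and EGDs have
   their own constructor. *)
Definition var := nat.
Definition cst := nat.
Definition predicate := (nat * nat)%type.
Definition arity (P : predicate) : nat := P.2.

Definition atom (T : Type) := (predicate * seq T)%type.
Definition wf_atom (T : Type) (a : atom T) : bool := size a.2 == arity a.1.
Definition map_atom (T U : Type) (f : T -> U) (a : atom T) : atom U :=
  (a.1, map f a.2).

(* A conjunction is the sequence of its atoms; [conj_vars] lists the variable
   occurrences from left to right, with repetitions. *)
Definition conjunction := seq (atom var).
Definition conj_vars (b : conjunction) : seq var := flatten (unzip2 b).

Definition tgd := (conjunction * conjunction)%type.
Definition egd := (conjunction * (var * var))%type.
Definition rule := (tgd + egd)%type.

Definition TGD (body head : conjunction) : rule := inl (body, head).
Definition EGD (body : conjunction) (x y : var) : rule := inr (body, (x, y)).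

Definition body (r : rule) : conjunction :=
  match r with inl t => t.1 | inr e => e.1 end.

(* The head variables of an EGD occur in its body when it is well formed. *)
Definition rule_vars (r : rule) : seq var :=
  match r with
  | inl t => conj_vars t.1 ++ conj_vars t.2
  | inr e => conj_vars e.1
  end.

Definition rule_preds (r : rule) : seq predicate :=
  match r with
  | inl t => unzip1 t.1 ++ unzip1 t.2
  | inr e => unzip1 e.1
  end.

Definition wf_conj (b : conjunction) : bool := (b != [::]) && all (@wf_atom _) b.

Definition wf_rule (r : rule) : bool :=
  match r with
  | inl t => wf_conj t.1 && wf_conj t.2
  | inr e => [&& wf_conj e.1, e.2.1 \in conj_vars e.1 & e.2.2 \in conj_vars e.1]
  end.

Definition wf_rules (R : {fset rule}) : Prop := forall r, r \in R -> wf_rule r.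

Definition preds (R : {fset rule}) : seq predicate :=
  flatten [seq rule_preds r | r <- enum_fset R].

(* In a TGD with body beta[x,y] and head eta[x,w], the tuple x consists of the
   variables common to body and head, and w of the variables of the head only. *)
Definition frontier (t : tgd) : seq var :=
  [seq x <- undup (conj_vars t.1) | x \in conj_vars t.2].

(* [Sk (t, w) ts] is f_w(ts). Indexing the function symbol by the TGD t as well
   as by w plays the role of the convention that different TGDs do not share
   existential variables. *)
Inductive term : Type :=
| Cst of cst
| Sk of (tgd * var)%type & seq term.

Fixpoint term_code (t : term) : GenTree.tree (cst + (tgd * var)) :=
  match t with
  | Cst c => GenTree.Leaf (inl c)
  | Sk f ts => GenTree.Node 0 (GenTree.Leaf (inr f) :: map term_code ts)
  end.

Fixpoint term_decode (t : GenTree.tree (cst + (tgd * var))) : term :=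
  match t with
  | GenTree.Node _ (GenTree.Leaf (inr f) :: ts) => Sk f (map term_decode ts)
  | GenTree.Leaf (inl c) => Cst c
  | _ => Cst 0
  end.

Lemma term_codeK : cancel term_code term_decode.
Proof.
rewrite /cancel; fix IH 1; case=> [c|f ts] //=; congr Sk.
by elim: ts => //= t ts IHts; congr cons; [exact: IH | exact: IHts].
Qed.

HB.instance Definition _ := Countable.copy term (can_type term_codeK).

Fixpoint term_depth (t : term) : nat :=
  match t with
  | Cst _ => 1
  | Sk _ ts => (foldr maxn 0 (map term_depth ts)).+1
  end.

Definition depth_order (le : rel term) : Prop :=
  [/\ reflexive le, antisymmetric le, transitive le, total le
    & forall t u, term_depth t < term_depth u -> le t u].

Definition fact := atom term.

Definition is_cst (t : term) : bool := if t is Cst _ then true else false.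

(* The finite, function-free fact sets from which a chase may start. *)
Definition fact_set (F : {fset fact}) : Prop :=
  forall a, a \in F -> wf_atom a && all is_cst a.2.

(* A substitution whose domain is the set of variables of some conjunction is
   represented by a total function, of which only the values on these
   variables matter. *)
Definition subst := var -> term.

Definition instance_in (s : subst) (b : conjunction) (F : {fset fact}) : Prop :=
  forall a, a \in b -> map_atom s a \in F.

Definition applicable (r : rule) (s : subst) (F : {fset fact}) : Prop :=
  instance_in s (body r) F /\
  match r with
  | inl t => ~ exists s' : subst,
               {in conj_vars t.1, s' =1 s} /\ instance_in s' t.2 F
  | inr e => s e.2.1 <> s e.2.2
  end.

Definition skolem_ext (t : tgd) (s : subst) : subst := fun v =>
  if v \in conj_vars t.1 then s v else Sk (t, v) (map s (frontier t)).

(* Only arguments of facts are replaced: a term occurring below a function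
   symbol is part of the name of a null. *)
Definition replace_term (t u : term) (F : {fset fact}) : {fset fact} :=
  [fset map_atom (fun v => if v == t then u else v) a | a in F].

Definition merge_terms (le : rel term) (t u : term)
    (F : {fset fact}) : {fset fact} :=
  if le t u then replace_term u t F else replace_term t u F.

Definition apply_rule (le : rel term) (r : rule) (s : subst)
    (F : {fset fact}) : {fset fact} :=
  match r with
  | inl t => F `|` [fset a in map (map_atom (skolem_ext t s)) t.2]
  | inr e => merge_terms le (s e.2.1) (s e.2.2) F
  end.

Definition chase_step (le : rel term) (R : {fset rule})
    (F F' : {fset fact}) : Prop :=
  exists r s, [/\ r \in R, applicable r s F & F' = apply_rule le r s F].

(* Sequences indexed by {0, ..., n} when [len = Some n], and by all natural
   numbers when [len = None]. *)
Definition in_range (len : option nat) (i : nat) : bool :=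
  if len is Some n then i <= n else true.

Definition chase_sequence (le : rel term) (R : {fset rule}) (F : {fset fact})
    (len : option nat) (Fs : nat -> {fset fact}) : Prop :=
  [/\ Fs 0 = F,
      forall i, in_range len i.+1 -> chase_step le R (Fs i) (Fs i.+1)
    & forall i r s, in_range len i -> r \in R -> applicable r s (Fs i) ->
        exists j, [/\ i < j, in_range len j & ~ applicable r s (Fs j)]].

Definition chase_terminates (le : rel term) (R : {fset rule}) : Prop :=
  forall F, fact_set F ->
  forall len Fs, chase_sequence le R F len Fs -> exists n, len = Some n.

(* An occurrence of a variable in b is a position in [conj_vars b]: [keep x] is
   the kept occurrence of x, and any other occurrence i is renamed [fresh i].
   The fresh variables must avoid [avoid], the variables of the whole rule. *)
Section Singularisation.
Variables (EQ : predicate) (keep : var -> nat) (fresh : nat -> var).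
Variable b : conjunction.

Definition occ (i : nat) : var := nth 0 (conj_vars b) i.

Definition renamed : seq nat :=
  [seq i <- iota 0 (size (conj_vars b)) | keep (occ i) != i].

Definition sing_vars : seq var :=
  [seq if i \in renamed then fresh i else occ i
  | i <- iota 0 (size (conj_vars b))].

Definition sing_conj : conjunction :=
  zip (unzip1 b) (reshape (shape (unzip2 b)) sing_vars)
  ++ [seq (EQ, [:: occ i; fresh i]) | i <- renamed].

Definition sing_choice (avoid : seq var) : Prop :=
  [/\ {in conj_vars b, forall x,
         keep x < size (conj_vars b) /\ occ (keep x) = x},
      {in renamed &, injective fresh}
    & {in renamed, forall i, fresh i \notin avoid}].
End Singularisation.

Definition singularisation (EQ : predicate) (avoid : seq var)
    (b b' : conjunction) : Prop :=
  exists keep fresh, sing_choice keep fresh b avoid /\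
                     b' = sing_conj EQ keep fresh b.

Definition rule_singularisation (EQ : predicate) (r r' : rule) : Prop :=
  exists2 b', singularisation EQ (rule_vars r) (body r) b' &
  r' = match r with
       | inl t => TGD b' t.2
       | inr e => TGD b' [:: (EQ, [:: e.2.1; e.2.2])]
       end.

Definition refl_rule (EQ P : predicate) : rule :=
  TGD [:: (P, iota 0 (arity P))]
      [seq (EQ, [:: i; i]) | i <- iota 0 (arity P)].

Definition sym_rule (EQ : predicate) : rule :=
  TGD [:: (EQ, [:: 0; 1])] [:: (EQ, [:: 1; 0])].

Definition trans_rule (EQ : predicate) : rule :=
  TGD [:: (EQ, [:: 0; 1]); (EQ, [:: 1; 2])] [:: (EQ, [:: 0; 2])].

(* Nullary predicates are skipped: their reflexivity rule has an empty head. *)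
Definition Sing (EQ : predicate) (R S : {fset rule}) : Prop :=
  exists c : rule -> rule,
    {in R, forall r, rule_singularisation EQ r (c r)} /\
    S = [fset c r | r in R]
        `|` [fset r in [seq refl_rule EQ P | P <- preds R & 0 < arity P]]
        `|` [fset sym_rule EQ; trans_rule EQ].

(* Main.v *)
(** An infinite fair chase F_0, F_1, ... of R is turned into an infinite fair
    chase of S in Sing(R). The latter runs through fact sets G_0, G_1, ... with
    maps g_n from the terms of G_n to those of F_n that send facts to facts and
    EQ to equality. Conversely, every fact of F_n lifts to a fact of G_n over a
    set of core terms, two of which are related by EQ as soon as g_n identifies
    them; hence a match of a rule body in F_n lifts to one of the singularised
    body in G_n, and the lifted rule is applicable because g_n would transport
    a match of its head to F_n.

    This alone does not give a fair chase: heads are not singularised, so a head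
    that holds in F_n thanks to merged terms may have to be introduced again in
    G_n. Such extra steps, which create nulls outside the core, are interleaved
    by dovetailing, once F_n offers a value for these nulls. It eventually does:
    as merging descends along a depth-compatible order, the image under g_n of a
    given match is eventually constant, and then fairness of the chase of R
    applies to it. *)

Require Import Defs.
From mathcomp Require Import all_boot.
From mathcomp Require Import finmap.
From mathcomp Require Import boolp.

Set Implicit Arguments.
Unset Strict Implicit.
Unset Printing Implicit Defensive.

(** * Atoms and terms of fact sets *)

Lemma map_atom_comp (T U V : Type) (f : U -> V) (g : T -> U) (a : atom T) :
  map_atom f (map_atom g a) = map_atom (f \o g) a.
Proof. by rewrite /map_atom /= -map_comp. Qed.

Lemma eq_in_map_atom (T : eqType) (U : Type) (f g : T -> U) (a : atom T) :
  {in a.2, f =1 g} -> map_atom f a = map_atom g a.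
Proof. by move=> fg; rewrite /map_atom; congr pair; apply/eq_in_map. Qed.

Lemma map_atom_id_in (T : eqType) (f : T -> T) (a : atom T) :
  {in a.2, f =1 id} -> map_atom f a = a.
Proof.
by case: a => P l fid; rewrite /map_atom /= (_ : map f l = l) // map_id_in.
Qed.

Definition fact_terms (F : {fset fact}) : seq term :=
  flatten [seq a.2 | a <- enum_fset F].

Lemma fact_termsP (u : term) (F : {fset fact}) :
  reflect (exists2 a, a \in F & u \in a.2) (u \in fact_terms F).
Proof. exact: flatten_mapP. Qed.

Lemma conj_varsP (v : var) (b : conjunction) :
  reflect (exists2 a, a \in b & v \in a.2) (v \in conj_vars b).
Proof. exact: flatten_mapP. Qed.

Lemma mem_conj_vars (v : var) (a : atom var) (b : conjunction) :
  a \in b -> v \in a.2 -> v \in conj_vars b.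
Proof. by move=> ab va; apply/conj_varsP; exists a. Qed.

Lemma fact_terms_sub (F F' : {fset fact}) :
  {subset F <= F'} -> {subset fact_terms F <= fact_terms F'}.
Proof. by move=> FF' u /fact_termsP[a /FF' aF' ua]; apply/fact_termsP; exists a. Qed.

Lemma instance_sub (s : subst) b (F F' : {fset fact}) :
  {subset F <= F'} -> instance_in s b F -> instance_in s b F'.
Proof. by move=> FF' sb a /sb/FF'. Qed.

Lemma eq_instance (s s' : subst) b F :
  {in conj_vars b, s' =1 s} -> instance_in s b F -> instance_in s' b F.
Proof.
move=> ss' sb a ab; rewrite (@eq_in_map_atom _ _ _ s) ?sb // => v va.
exact: ss' (mem_conj_vars ab va).
Qed.

Lemma instance_terms (s : subst) b F (v : var) :
  instance_in s b F -> v \in conj_vars b -> s v \in fact_terms F.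
Proof.
move=> sb /conj_varsP[a ab va]; apply/fact_termsP.
by exists (map_atom s a); [exact: sb | exact: map_f].
Qed.

Lemma mem_frontier (t : tgd) (v : var) :
  (v \in frontier t) = (v \in conj_vars t.2) && (v \in conj_vars t.1).
Proof. by rewrite mem_filter mem_undup. Qed.

Lemma skolem_ext_body (t : tgd) (s : subst) (v : var) :
  v \in conj_vars t.1 -> skolem_ext t s v = s v.
Proof. by rewrite /skolem_ext => ->. Qed.

Lemma map_skolem_frontier (t : tgd) (s : subst) :
  map (skolem_ext t s) (frontier t) = map s (frontier t).
Proof.
by apply/eq_in_map => v; rewrite mem_frontier => /andP[_ /skolem_ext_body->].
Qed.

Definition add_head (t : tgd) (s : subst) (F : {fset fact}) : {fset fact} :=
  (F `|` [fset a in map (map_atom (skolem_ext t s)) t.2])%fset.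

Lemma add_headP (t : tgd) (s : subst) (F : {fset fact}) (a : fact) :
  reflect (a \in F \/ exists2 h, h \in t.2 & a = map_atom (skolem_ext t s) h)
    (a \in add_head t s F).
Proof.
rewrite !inE /=; apply: (iffP orP) => -[|]; try by left.
  by move=> /mapP; right.
by move=> ha; right; apply/mapP.
Qed.

Lemma sub_add_head (t : tgd) (s : subst) (F : {fset fact}) :
  {subset F <= add_head t s F}.
Proof. by move=> a aF; apply/add_headP; left. Qed.

Lemma instance_add_head (t : tgd) (s : subst) (F : {fset fact}) :
  instance_in (skolem_ext t s) t.2 (add_head t s F).
Proof. by move=> a at2; apply/add_headP; right; exists a. Qed.

Lemma terms_add_head (t : tgd) (s : subst) (F : {fset fact}) (u : term) :
  u \in fact_terms (add_head t s F) ->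
  u \in fact_terms F \/ exists2 v, v \in conj_vars t.2 & u = skolem_ext t s v.
Proof.
case/fact_termsP=> a /add_headP[aF ua|[h ht ->] /mapP[v vh ->]].
  by left; apply/fact_termsP; exists a.
by right; exists v => //; exact: mem_conj_vars ht vh.
Qed.

Definition rename_term (p q : term) : term -> term := fun v => if v == p then q else v.

Lemma replace_termP (p q : term) (F : {fset fact}) (a : fact) :
  reflect (exists2 b, b \in F & a = map_atom (rename_term p q) b)
    (a \in replace_term p q F).
Proof. exact: imfsetP. Qed.

Lemma map_replace (p q : term) (F : {fset fact}) (a : fact) :
  a \in F -> map_atom (rename_term p q) a \in replace_term p q F.
Proof. by move=> aF; apply/replace_termP; exists a. Qed.

Lemma terms_replace (p q : term) (F : {fset fact}) (u : term) :
  u \in fact_terms (replace_term p q F) ->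
  exists2 v, v \in fact_terms F & u = rename_term p q v.
Proof.
case/fact_termsP=> _ /replace_termP[b bF ->] /mapP[v vb ->].
by exists v => //; apply/fact_termsP; exists b.
Qed.

(** * Nulls are introduced at most once *)

(* [E] collects the terms that occurred so far. A null seen earlier is either
   dead for good, as one of its arguments was merged away, or witnesses that
   the head that introduced it still holds. *)
Definition nulls_justified (E : term -> Prop) (F : {fset fact}) : Prop :=
  (forall u, u \in fact_terms F -> E u) /\
  forall (t : tgd) w ts, E (Sk (t, w) ts) ->
    (forall u, u \in ts -> E u) /\
    ((exists2 u, u \in ts & u \notin fact_terms F) \/
     exists2 s : subst, map s (frontier t) = ts & instance_in s t.2 F).

(** The arguments of such a null are body matches, hence terms of [F], so it is not dead. A
    surviving witness of its head would agree with [s] on the frontier and could be glued to [s],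
    against applicability. *)
Lemma fresh_null (E : term -> Prop) (F : {fset fact}) (t : tgd) (s : subst) :
  nulls_justified E F -> applicable (inl t) s F ->
  forall w, ~ E (Sk (t, w) (map s (frontier t))).
Proof.
move=> [_ EF] [/= sb nsat] w /EF[_ [[u]|[s0 s0s s0h]]].
  case/mapP=> v; rewrite mem_frontier => /andP[_ vb] ->.
  by rewrite (instance_terms sb vb).
apply: nsat; exists (fun v => if v \in conj_vars t.1 then s v else s0 v).
split=> [v -> //|]; apply: eq_instance s0h => v vh.
case: ifP => // vb.
have vf : v \in frontier t by rewrite mem_frontier vh vb.
by move/eq_in_map: s0s => /(_ v vf).
Qed.

Lemma nulls_justified_tgd (E : term -> Prop) F (t : tgd) (s : subst) :
  nulls_justified E F -> applicable (inl t) s F ->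
  nulls_justified (fun u => E u \/ u \in fact_terms (add_head t s F))
    (add_head t s F).
Proof.
move=> EF app; have fresh := fresh_null EF app.
have [[EF1 EF2] [/= sb nsat]] := (EF, app).
(* Seen terms do not come back: a term of the new set is either a term of [F] or a null that was
   never seen. So dead nulls stay dead. *)
have old u : u \in fact_terms (add_head t s F) -> E u -> u \in fact_terms F.
  move=> /terms_add_head[//|[v vh ->]]; rewrite /skolem_ext; case: ifP => [vb _|_ /fresh//].
  exact: instance_terms sb vb.
split=> [u|t1 w ts]; first by right.
have caseE : E (Sk (t1, w) ts) \/
    (t1 = t /\ ts = map s (frontier t)) ->
  (forall u, u \in ts -> E u \/ u \in fact_terms (add_head t s F)) /\
  ((exists2 u, u \in ts & u \notin fact_terms (add_head t s F)) \/
   exists2 s' : subst, map s' (frontier t1) = ts &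
     instance_in s' t1.2 (add_head t s F)).
  case=> [/EF2[tsE H]|[-> ->]]; split.
  - by move=> u /tsE; left.
  - case: H => [[u uts uF]|[s0 s0s s0h]].
      by left; exists u => //; apply: contra uF => /old; apply; exact: tsE.
    by right; exists s0 => //; apply: instance_sub s0h; exact: sub_add_head.
  - move=> u /mapP[v]; rewrite mem_frontier => /andP[_ vb] ->.
    by left; apply: EF1; exact: instance_terms sb vb.
  - right; exists (skolem_ext t s); first exact: map_skolem_frontier.
    exact: instance_add_head.
case=> [Eu|/terms_add_head]; first by apply: caseE; left.
case=> [/EF1 Eu|[v vh]]; first by apply: caseE; left.
rewrite /skolem_ext; case: ifP => [vb e|_ [? _ ?]]; last by apply: caseE; right.
by apply: caseE; left; apply: EF1; rewrite e; exact: instance_terms sb vb.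
Qed.

(** Nulls with [p] among their arguments die, as [p] disappears for good. For the others, renaming
    fixes all arguments, so composing the old witness with it gives a new one. *)
Lemma nulls_justified_replace (E : term -> Prop) F (p q : term) :
  nulls_justified E F -> p != q -> q \in fact_terms F ->
  nulls_justified E (replace_term p q F).
Proof.
move=> [EF1 EF2] pq qF.
have sub u : u \in fact_terms (replace_term p q F) -> u \in fact_terms F /\ u != p.
  case/terms_replace => v vF ->; rewrite /rename_term; case: eqVneq => // _.
  by rewrite eq_sym.
split=> [u /sub[/EF1] //|t w ts /EF2[tsE H]]; split=> //.
case: H => [[u uts uF]|[s ss sh]].
  by left; exists u => //; apply: contra uF => /sub[].
case: (boolP (p \in ts)) => pts.
  by left; exists p => //; apply/negP => /sub[_]; rewrite eqxx.
right; exists (rename_term p q \o s).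
  rewrite map_comp ss map_id_in // => u uts; rewrite /rename_term; case: eqP => // up.
  by rewrite -up uts in pts.
by move=> a /sh aF; rewrite -map_atom_comp; exact: map_replace.
Qed.

(** * Chase steps, and the finitely many terms of bounded depth *)

Lemma merge_termsP (le : rel term) (x y : term) (F : {fset fact}) :
  total le ->
  exists p q, [/\ (p, q) = (x, y) \/ (p, q) = (y, x), le q p
                & merge_terms le x y F = replace_term p q F].
Proof.
move=> le_total; rewrite /merge_terms; case: ifP => le_xy.
  by exists y, x; split=> //; right.
by exists x, y; split=> //; [left | have := le_total x y; rewrite le_xy].
Qed.

Definition is_fresh (t : tgd) (s : subst) (F : {fset fact}) : Prop :=
  forall w, Sk (t, w) (map s (frontier t)) \notin fact_terms F.

Lemma nulls_justified_fresh F t s :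
  (exists E, nulls_justified E F) -> applicable (inl t) s F -> is_fresh t s F.
Proof.
by case=> E EF app w; apply/negP => /(proj1 EF); exact: (fresh_null EF app).
Qed.

Lemma nulls_justified_step (le : rel term) (r : rule) (s : subst) F :
  total le -> wf_rule r -> applicable r s F ->
  (exists E, nulls_justified E F) ->
  exists E, nulls_justified E (apply_rule le r s F).
Proof.
move=> le_total; case: r => [t|[b [x y]]] wf app [E EF].
  by exists (fun u => E u \/ u \in fact_terms (add_head t s F));
    exact: nulls_justified_tgd.
exists E => /=; case: app => /= sb nxy; case/and3P: wf => /= _ xb yb.
have [p [q [pq _ ->]]] := merge_termsP (s x) (s y) F le_total.
apply: nulls_justified_replace => //.
  by apply/eqP => e; case: pq => -[??]; apply: nxy; congruence.
by case: pq => -[_ ->]; exact: instance_terms sb _.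
Qed.

Lemma nulls_justified_constants F :
  fact_set F -> exists E, nulls_justified E F.
Proof.
move=> FF; exists (fun u => u \in fact_terms F); split=> // t w ts.
by case/fact_termsP => a /FF/andP[_ /allP ac] /ac.
Qed.

Section Signature.
Variables (R : {fset rule}) (K : seq term).

(** An invariant of the terms met by the chase of [R]: function symbols come from the existential
    positions of finitely many rules and have fixed arity, so each depth bound leaves finitely many
    terms. *)
Fixpoint over_sig (u : term) : bool :=
  match u with
  | Cst _ => u \in K
  | Sk f ts => [&& inl f.1 \in R, f.2 \in conj_vars f.1.2,
                   size ts == size (frontier f.1) & all over_sig ts]
  end.

Definition words (L : seq term) (n : nat) : seq (seq term) :=
  iter n (fun W => [seq u :: w | u <- L, w <- W]) [:: [::]].

Lemma mem_words (L w : seq term) : {subset w <= L} -> w \in words L (size w).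
Proof.
elim: w => //= u w IH uwL; apply/allpairsP; exists (u, w); split=> //=.
  by apply: uwL; rewrite inE eqxx.
by apply: IH => v vw; apply: uwL; rewrite inE vw orbT.
Qed.

Definition rule_nulls (L : seq term) (r : rule) : seq term :=
  match r with
  | inl t => [seq Sk (t, w) ts | w <- conj_vars t.2,
                                 ts <- words L (size (frontier t))]
  | inr _ => [::]
  end.

Definition layer (d : nat) : seq term :=
  iter d (fun L => K ++ flatten [seq rule_nulls L r | r <- enum_fset R]) [::].

Lemma mem_layer (d : nat) (u : term) :
  over_sig u -> term_depth u <= d -> u \in layer d.
Proof.
elim: d u => [|d IH] [c|[t w] ts] //=; rewrite mem_cat; first by move=> ->.
case/and4P=> tR wt /eqP szts /allP tsK; rewrite ltnS => depth_ts.
apply/orP; right; apply/flatten_mapP; exists (inl t) => //=.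
apply/allpairsP; exists (w, ts); split=> //=; rewrite -szts; apply: mem_words.
move=> u uts; apply: IH; first exact: tsK.
apply: leq_trans depth_ts.
elim: ts uts {szts tsK} => //= v ts IHts; rewrite inE leq_max => /orP[/eqP->|/IHts->].
  by rewrite leqnn.
by rewrite orbT.
Qed.

Lemma over_sig_step (le : rel term) (r : rule) (s : subst) F :
  total le -> r \in R -> wf_rule r -> applicable r s F ->
  {in fact_terms F, forall u, over_sig u} ->
  {in fact_terms (apply_rule le r s F), forall u, over_sig u}.
Proof.
move=> le_total; case: r => [t|[b [x y]]] rR wf [/= sb app] FK u.
  case/terms_add_head=> [/FK//|[v vt ->]]; rewrite /skolem_ext.
  case: ifP => [vb|_]; first exact: FK (instance_terms sb vb).
  rewrite /= rR vt size_map eqxx; apply/allP => _ /mapP[z + ->].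
  by rewrite mem_frontier => /andP[_ zb]; exact: FK (instance_terms sb zb).
have [p [q [pq _ ->]]] := merge_termsP (s x) (s y) F le_total.
case/terms_replace => v vF ->; rewrite /rename_term; case: eqP => _; last exact: FK.
case/and3P: wf => /= _ xb yb; apply: FK.
by case: pq => -[_ ->]; exact: instance_terms sb _.
Qed.

(** The decreasing measure behind both termination arguments: stabilisation of descending sequences,
    and saturation under the equality rules. *)
Lemma ltn_count (T : eqType) (a b : pred T) (L : seq T) (z : T) :
  subpred a b -> z \in L -> b z -> ~~ a z -> count a L < count b L.
Proof.
move=> ab + bz az; elim: L => //= u L IH; rewrite inE => /orP[/eqP<-|/IH lt].
  by rewrite bz (negPf az) add0n add1n ltnS sub_count.
by rewrite -addnS leq_add //; case: (boolP (a u)) => // /ab->.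
Qed.

(* Depth cannot increase along a [le]-descending sequence, so it stays in a
   finite layer. *)
Lemma descending_stationary (le : rel term) (x : nat -> term) (m : nat) :
  depth_order le ->
  (forall n, m <= n -> over_sig (x n)) ->
  (forall n, m <= n -> le (x n.+1) (x n)) ->
  exists2 N, m <= N & forall n, N <= n -> x n = x N.
Proof.
case=> le_refl le_anti le_trans _ le_depth xK dec.
have le_x i j : m <= i -> i <= j -> le (x j) (x i).
  move=> mi /subnK<-; elim: (j - i) => // k IH.
  by rewrite addSn; apply: le_trans IH; apply: dec; rewrite (leq_trans mi) ?leq_addl.
(* A deeper term is [le]-above a shallower one; being also [le]-below it in the sequence, it would
   be equal to it. *)
have depth_x n : m <= n -> term_depth (x n) <= term_depth (x m).
  move=> mn; rewrite leqNgt; apply/negP => lt; have le1 := le_depth _ _ lt.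
  suff e : x n = x m by rewrite e ltnn in lt.
  by apply: le_anti; rewrite le1 le_x.
pose L := layer (term_depth (x m)).
have xL n : m <= n -> x n \in L by move=> mn; apply: mem_layer; [exact: xK | exact: depth_x].
(* Induction on the number of terms of [L] that lie below [x n]. Whenever the sequence changes, the
   abandoned term stops being counted. *)
suff H c n : m <= n -> count (fun u => le u (x n)) L < c ->
    exists2 N, n <= N & forall k, N <= k -> x k = x N.
  by apply: H (leqnn m) (ltnSn _).
elim: c n => // c IH n mn; rewrite ltnS => cnt.
have [H|] := EM (forall k, n <= k -> x k = x n); first by exists n.
case/existsNP => k /not_implyP[nk xkn].
have mk := leq_trans mn nk.
have [|N kN HN] := IH k mk; last by exists N => //; exact: leq_trans kN.
apply: leq_trans cnt; apply: (ltn_count (z := x n)) => //; first last.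
- apply/negP => lenk; apply: xkn; apply: le_anti.
  by rewrite lenk le_x.
- exact: xL.
by move=> u lek; apply: le_trans lek _; exact: le_x.
Qed.

End Signature.

(** * Matches of a conjunction and of its singularisation *)

Lemma zip_conj (T : Type) (b : seq (atom T)) :
  zip (unzip1 b) (reshape (shape (unzip2 b)) (flatten (unzip2 b))) = b.
Proof. by rewrite flattenK zip_unzip. Qed.

Lemma map_atom_zip (T U : Type) (f : T -> U) ps (sh : seq nat) (xs : seq T) :
  map (map_atom f) (zip ps (reshape sh xs)) = zip ps (reshape sh (map f xs)).
Proof.
rewrite -map_reshape; elim: ps (reshape sh xs) => [|p ps IH] [|y ys] //=.
by rewrite IH.
Qed.

Section Singularise.
Variables (EQ : predicate) (keep : var -> nat) (fresh : nat -> var).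
Variables (b : conjunction) (avoid : seq var).
Hypothesis choice_b : sing_choice keep fresh b avoid.
Hypothesis b_avoid : {subset conj_vars b <= avoid}.

Let b' := sing_conj EQ keep fresh b.
Let n := size (conj_vars b).

Lemma mem_renamed i : (i \in renamed keep b) = (i < n) && (keep (occ b i) != i).
Proof. by rewrite mem_filter mem_iota andbC. Qed.

Lemma occ_mem i : i < n -> occ b i \in conj_vars b.
Proof. exact: mem_nth. Qed.

Lemma size_sing_vars : size (sing_vars keep fresh b) = n.
Proof. by rewrite size_map size_iota. Qed.

Lemma mem_sing_conj_vars v :
  (v \in conj_vars b') =
  (v \in sing_vars keep fresh b) ||
  has (fun i => (v == occ b i) || (v == fresh i)) (renamed keep b).
Proof.
rewrite /conj_vars /unzip2 /b' map_cat flatten_cat mem_cat; congr (_ || _).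
  rewrite -/(unzip2 (zip _ _)) unzip2_zip.
    by rewrite reshapeKr // size_sing_vars /n size_flatten.
  by rewrite size_reshape /shape !size_map.
by elim: (renamed keep b) => //= i l IH; rewrite !inE IH orbA.
Qed.

(** The kept occurrence of a variable carries its original name. *)
Lemma sub_sing_conj_vars : {subset conj_vars b <= conj_vars b'}.
Proof.
move=> v vb; rewrite mem_sing_conj_vars; apply/orP; left.
have [keepP _ _] := choice_b; have [kn ok] := keepP v vb.
apply/mapP; exists (keep v); first by rewrite mem_iota.
by rewrite mem_renamed kn ok eqxx.
Qed.

Lemma sing_conj_varsP v :
  v \in conj_vars b' -> v \in conj_vars b \/ v \notin avoid.
Proof.
have [_ _ fr] := choice_b; rewrite mem_sing_conj_vars => /orP[/mapP[i]|/hasP[i ir]].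
  rewrite mem_iota => /= ilt ->; case: ifP => ir; first by right; exact: fr.
  by left; exact: occ_mem.
case/orP=> /eqP->; last by right; exact: fr.
by left; apply: occ_mem; move: ir; rewrite mem_renamed => /andP[].
Qed.

(** When [EQ] means equality, the added atoms force every renamed occurrence to take the value of
    its variable, so both lists of occurrences have the same image under [s]. *)
Lemma unsing (P : fact -> Prop) (s : subst) :
  (forall u v, P (EQ, [:: u; v]) -> u = v) ->
  (forall a, a \in b' -> P (map_atom s a)) ->
  forall a, a \in b -> P (map_atom s a).
Proof.
move=> PEQ sb' a ab.
have svars : map s (sing_vars keep fresh b) = map s (conj_vars b).
  apply: (@eq_from_nth _ (s 0)); rewrite !size_map ?size_iota // => i ilt.
  rewrite (nth_map 0) ?size_sing_vars // (nth_map 0) ?size_iota // nth_iota //.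
  rewrite add0n (nth_map 0) //; case: ifP => // ir.
  symmetry; apply: PEQ; apply: (sb' (EQ, [:: occ b i; fresh i])).
  by rewrite mem_cat; apply/orP; right; apply/mapP; exists i.
have : map_atom s a \in map (map_atom s) b by exact: map_f.
rewrite -{1}(zip_conj b) map_atom_zip -svars -map_atom_zip => /mapP[c cb ->].
by apply: sb'; rewrite mem_cat cb.
Qed.

(** The terms of [L], read from left to right, assign a value to each occurrence separately. Values
    given to occurrences of one variable may differ, but [g] identifies them, and the [EQ] atoms
    state no more than that. *)
Lemma lift_match (g : term -> term) (s : subst) (L : seq fact) :
  map (map_atom g) L = map (map_atom s) b ->
  exists s' : subst,
    [/\ {in conj_vars b, g \o s' =1 s},
        {in conj_vars b', forall v, s' v \in flatten (unzip2 L)}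
      & forall a, a \in b' -> map_atom s' a \in L \/
          exists u v, [/\ u \in flatten (unzip2 L), v \in flatten (unzip2 L),
                          g u = g v & map_atom s' a = (EQ, [:: u; v])]].
Proof.
move=> Ls; have [keepP freshI freshA] := choice_b.
pose flat := flatten (unzip2 L).
have L1 : unzip1 L = unzip1 b.
  by have := congr1 unzip1 Ls; rewrite /unzip1 -!map_comp.
have L2 : [seq map g l | l <- unzip2 L] = [seq map s l | l <- unzip2 b].
  by have := congr1 unzip2 Ls; rewrite /unzip2 -!map_comp.
have Lsh : shape (unzip2 L) = shape (unzip2 b).
  have := congr1 shape L2; rewrite /shape -[LHS]map_comp -[RHS]map_comp.
  by rewrite (eq_map (size_map g)) (eq_map (size_map s)).
have gflat : map g flat = map s (conj_vars b) by rewrite !map_flatten L2.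
have szflat : size flat = n by rewrite -(size_map g) gflat size_map.
(* An original variable takes the term at its kept position. A fresh one takes the term at the
   position it renames, recovered by inverting [fresh] on [renamed keep b]. *)
pose s' v := if v \in conj_vars b then nth (Cst 0) flat (keep v)
  else nth (Cst 0) flat (nth 0 (renamed keep b) (index v (map fresh (renamed keep b)))).
have s'_occ i : i < n -> s' (occ b i) = nth (Cst 0) flat (keep (occ b i)).
  by move=> ilt; rewrite /s' occ_mem.
(* Fresh variables avoid those of [b], which excludes the first branch, and injectivity of [fresh]
   makes the inversion exact. *)
have s'_fresh i : i \in renamed keep b -> s' (fresh i) = nth (Cst 0) flat i.
  move=> ir; rewrite /s'; case: ifP => [/b_avoid|_].
    by rewrite (negPf (freshA i ir)).
  suff -> : index (fresh i) (map fresh (renamed keep b)) = index i (renamed keep b).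
    by rewrite nth_index.
  elim: (renamed keep b) (ir) freshI => //= j l IH + inj.
  rewrite inE; case: (eqVneq j i) => [->|ji] /=; first by rewrite eqxx.
  move=> il.
  have -> : (fresh j == fresh i) = false.
    by apply: contraNF ji => /eqP e; apply/eqP; apply: inj; rewrite ?inE ?eqxx ?il ?orbT.
  by rewrite IH // => x y xl yl; apply: inj; rewrite inE ?xl ?yl orbT.
have g_nth i : i < n -> g (nth (Cst 0) flat i) = s (occ b i).
  move=> ilt; rewrite -(nth_map _ (g (Cst 0)) g) ?szflat // gflat.
  by rewrite (nth_map 0).
have keep_lt i : i < n -> keep (occ b i) < n.
  by move=> /occ_mem/keepP[].
have nth_flat i : i < n -> nth (Cst 0) flat i \in flat.
  by move=> ilt; rewrite mem_nth ?szflat.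
exists s'; split.
- move=> v vb /=; rewrite /s' vb; have [klt ok] := keepP v vb.
  by rewrite g_nth // ok.
- move=> v; rewrite mem_sing_conj_vars => /orP[/mapP[i]|/hasP[i ir]].
    rewrite mem_iota => /= ilt ->; case: ifP => [/s'_fresh->|_]; first exact: nth_flat.
    by rewrite s'_occ //; apply/nth_flat/keep_lt.
  have ilt : i < n by move: ir; rewrite mem_renamed => /andP[].
  case/orP=> /eqP->; first by rewrite s'_occ //; apply/nth_flat/keep_lt.
  by rewrite s'_fresh //; exact: nth_flat.
move=> a; rewrite mem_cat => /orP[ab|/mapP[i ir ->]]; [left|right].
  rewrite -(zip_conj L) L1 Lsh -/flat.
  rewrite (_ : flat = map s' (sing_vars keep fresh b)); last first.
    apply: (@eq_from_nth _ (Cst 0)); rewrite szflat; first by rewrite size_map size_sing_vars.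
    move=> i ilt; rewrite (nth_map 0) ?size_sing_vars //.
    rewrite (nth_map 0) ?size_iota // nth_iota // add0n; case: ifP => ir.
      by rewrite s'_fresh.
    rewrite s'_occ //; move/negbT: ir.
    by rewrite mem_renamed ilt negbK => /eqP->.
  by rewrite -map_atom_zip map_f.
have ilt : i < n by move: ir; rewrite mem_renamed => /andP[].
exists (nth (Cst 0) flat (keep (occ b i))), (nth (Cst 0) flat i); split.
- exact/nth_flat/keep_lt.
- exact: nth_flat.
- rewrite !g_nth ?keep_lt //; congr s; exact: (keepP _ (occ_mem ilt)).2.
by rewrite /map_atom /= s'_occ // s'_fresh.
Qed.

End Singularise.

(** * Simulating the chase of a rule set by that of its singularisation *)

Fixpoint chase_steps (le : rel term) (S : {fset rule}) (n : nat)
    (G G' : {fset fact}) : Prop :=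
  if n is n'.+1 then exists2 G1, chase_step le S G G1 & chase_steps le S n' G1 G'
  else G = G'.

Lemma chase_steps_trans le S m n G1 G2 G3 :
  chase_steps le S m G1 G2 -> chase_steps le S n G2 G3 ->
  chase_steps le S (m + n) G1 G3.
Proof.
elim: m G1 => [|m IH] G1 /=; first by move=> ->.
by case=> G st /IH H /H; exists G.
Qed.

Definition satisfied (t : tgd) (s : subst) (G : {fset fact}) : Prop :=
  exists s' : subst, {in conj_vars t.1, s' =1 s} /\ instance_in s' t.2 G.

Lemma satisfied_sub t s (G G' : {fset fact}) :
  {subset G <= G'} -> satisfied t s G -> satisfied t s G'.
Proof. by move=> GG' [s' [s's s'h]]; exists s'; split=> //; exact: instance_sub s'h. Qed.

Lemma satisfied_add_head t s G : satisfied t s (add_head t s G).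
Proof.
exists (skolem_ext t s); split; last exact: instance_add_head.
by move=> v /skolem_ext_body->.
Qed.

Section Simulation.
Variables (le : rel term) (EQ : predicate) (R S : {fset rule}).
Hypotheses (le_refl : reflexive le) (le_total : total le).
Hypotheses (EQ_fresh : EQ \notin preds R) (R_wf : wf_rules R).

(* Facts of [F], with [EQ] read as equality. *)
Definition holds (F : {fset fact}) (a : fact) : Prop :=
  (a.1 \in preds R /\ a \in F) \/
  exists2 u, u \in fact_terms F & a = (EQ, [:: u; u]).

Lemma holds_EQ F u v : holds F (EQ, [:: u; v]) -> u = v /\ u \in fact_terms F.
Proof.
case=> [[/= EQR]|[w wF [-> ->]] //].
by move: EQ_fresh; rewrite EQR.
Qed.

Lemma holds_pred F a : holds F a -> a.1 \in preds R -> a \in F.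
Proof. by case=> [[]//|[u _ ->]] /= EQR; move: EQ_fresh; rewrite EQR. Qed.

Definition hom (g : term -> term) (G F : {fset fact}) : Prop :=
  forall a, a \in G -> holds F (map_atom g a).

Lemma hom_terms g G F u : hom g G F -> u \in fact_terms G -> g u \in fact_terms F.
Proof.
move=> hg /fact_termsP[a /hg[[_ aF]|[w wF ew]] ua].
  by apply/fact_termsP; exists (map_atom g a); rewrite ?map_f.
have := map_f g ua; case: ew => _ ->.
by rewrite !inE orbb => /eqP->.
Qed.

Lemma eq_hom g g' G F : {in fact_terms G, g' =1 g} -> hom g G F -> hom g' G F.
Proof.
move=> gg' hg a aG; rewrite (@eq_in_map_atom _ _ _ g); first exact: hg.
by move=> u ua; apply: gg'; apply/fact_termsP; exists a.
Qed.

(** Only the frontier is prescribed, so [s'] supplies values in [F] for the existential variables.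
    Since [holds] reads [EQ] as equality, this also covers the heads of singularised EGDs. *)
Definition head_holds (F : {fset fact}) (t : tgd) (s : subst) : Prop :=
  exists2 s' : subst, {in frontier t, s' =1 s} &
    forall a, a \in t.2 -> holds F (map_atom s' a).

(** As the nulls of this application do not occur in [G], the map can be redefined on them, sending
    the null of [w] to [s' w], without affecting [G]. *)
Lemma extend_hom g G F t (s s' : subst) :
  hom g G F -> is_fresh t s G -> instance_in s t.1 G ->
  {in frontier t, s' =1 g \o s} ->
  (forall a, a \in t.2 -> holds F (map_atom s' a)) ->
  exists g', [/\ {in fact_terms G, g' =1 g},
    {in conj_vars t.2, g' \o skolem_ext t s =1 s'} & hom g' (add_head t s G) F].
Proof.
move=> hg fresh sb s'f s'h.
pose new u := if u is Sk f ts then (f.1 == t) && (ts == map s (frontier t)) else false.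
pose g' u := if u is Sk f ts then if new u then s' f.2 else g u else g u.
have g'G : {in fact_terms G, g' =1 g}.
  case=> [//|[t' w] ts] uG /=; case: andP => // -[/eqP/= et /eqP ets].
  by move: uG; rewrite et ets (negPf (fresh w)).
have g's : {in conj_vars t.2, g' \o skolem_ext t s =1 s'}.
  move=> v vh; rewrite /= /skolem_ext; case: ifP => [vb|_].
    rewrite g'G ?(instance_terms sb vb) //.
    by rewrite -[g _]/((g \o s) v) -s'f // mem_frontier vh vb.
  by rewrite /= !eqxx.
exists g'; split=> // a /add_headP[aG|[h ht ->]]; first exact: (eq_hom g'G).
rewrite map_atom_comp (@eq_in_map_atom _ _ _ s'); first exact: s'h.
by move=> v vh; apply: g's; exact: mem_conj_vars ht vh.
Qed.

(** * Equality rules and saturation *)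

Definition eq_rules : seq rule :=
  [seq refl_rule EQ P | P <- preds R & 0 < arity P]
  ++ [:: sym_rule EQ; trans_rule EQ].

Hypothesis eq_rules_S : {subset eq_rules <= S}.

Definition eq_closed (G : {fset fact}) : Prop :=
  forall t s, inl t \in eq_rules -> instance_in s t.1 G -> satisfied t s G.

Lemma eq_rules_ind (P : tgd -> Prop) :
  (forall p, p \in preds R -> P ([:: (p, iota 0 (arity p))],
     [seq (EQ, [:: i; i]) | i <- iota 0 (arity p)])) ->
  P ([:: (EQ, [:: 0; 1])], [:: (EQ, [:: 1; 0])]) ->
  P ([:: (EQ, [:: 0; 1]); (EQ, [:: 1; 2])], [:: (EQ, [:: 0; 2])]) ->
  forall t, inl t \in eq_rules -> P t.
Proof.
move=> Pr Ps Pt t; rewrite mem_cat => /orP[/mapP[p]|].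
  by rewrite mem_filter => /andP[_ pR] [->]; exact: Pr.
by rewrite !inE => /orP[] /eqP[->].
Qed.

(** Equality rules have no existential variables, so applying them creates no terms. *)
Lemma eq_rules_head t h : inl t \in eq_rules -> h \in t.2 ->
  exists x y, [/\ x \in conj_vars t.1, y \in conj_vars t.1 & h = (EQ, [:: x; y])].
Proof.
move=> tE; move: t tE h; apply: eq_rules_ind => [p pR h /mapP[i ip ->]|h|h].
- by exists i, i; rewrite /conj_vars /= cats0.
- by rewrite inE => /eqP->; exists 1, 0.
- by rewrite inE => /eqP->; exists 0, 2.
Qed.

Lemma eq_rules_sound g G F t s : hom g G F -> inl t \in eq_rules ->
  instance_in s t.1 G -> forall h, h \in t.2 -> holds F (map_atom (g \o s) h).
Proof.
move=> hg tE; move: t tE s; apply: eq_rules_ind => [p pR s sb h /mapP[i ip ->]|s sb h|s sb h].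
- right; exists (g (s i)) => //; apply: hom_terms hg _.
  by apply: instance_terms sb _; rewrite /conj_vars /= cats0.
- have /hg/holds_EQ[e eF] := sb (EQ, [:: 0; 1]) (mem_head _ _).
  rewrite inE => /eqP->; right; exists (g (s 0)) => //.
  by rewrite /map_atom /= e.
have /hg/holds_EQ[e eF] := sb (EQ, [:: 0; 1]) (mem_head _ _).
have /hg/holds_EQ[e' _] : map_atom s (EQ, [:: 1; 2]) \in G.
  by apply: sb; rewrite !inE eqxx orbT.
rewrite inE => /eqP->; right; exists (g (s 0)) => //.
by rewrite /map_atom /= e e'.
Qed.

Lemma eq_closed_refl G a u : eq_closed G -> a \in G -> a.1 \in preds R ->
  wf_atom a -> u \in a.2 -> (EQ, [:: u; u]) \in G.
Proof.
move=> cG aG aR /eqP wfa ua.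
pose i := index u a.2.
have ilt : i < arity a.1 by rewrite -wfa index_mem.
have tE : refl_rule EQ a.1 \in eq_rules.
  rewrite mem_cat; apply/orP; left; apply/mapP; exists a.1 => //.
  by rewrite mem_filter aR (leq_ltn_trans _ ilt).
(* The variables of the reflexivity rule are argument positions, so the argument list itself is the
   match. *)
pose s : subst := nth u a.2.
have [|s' [s's s'h]] := cG _ s tE.
  move=> h; rewrite inE => /eqP->; rewrite /map_atom /= -wfa.
  by rewrite -/(mkseq s (size a.2)) mkseq_nth -surjective_pairing.
have /s'h : (EQ, [:: i; i]) \in [seq (EQ, [:: i; i]) | i <- iota 0 (arity a.1)].
  by apply/mapP; exists i => //; rewrite mem_iota.
rewrite /map_atom /= s's; last by rewrite /conj_vars /= cats0 mem_iota.
by rewrite /s nth_index.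
Qed.

Lemma eq_closed_sym G u v : eq_closed G -> (EQ, [:: u; v]) \in G ->
  (EQ, [:: v; u]) \in G.
Proof.
move=> cG uvG.
have tE : sym_rule EQ \in eq_rules by rewrite mem_cat !inE eqxx !orbT.
have [|s' [s's s'h]] := cG _ (nth u [:: u; v]) tE.
  by move=> h; rewrite inE => /eqP->.
by have := s'h _ (mem_head _ _); rewrite /map_atom /= !s's.
Qed.

Lemma eq_closed_trans G u v w : eq_closed G -> (EQ, [:: u; v]) \in G ->
  (EQ, [:: v; w]) \in G -> (EQ, [:: u; w]) \in G.
Proof.
move=> cG uvG vwG.
have tE : trans_rule EQ \in eq_rules by rewrite mem_cat !inE eqxx !orbT.
have [|s' [s's s'h]] := cG _ (nth u [:: u; v; w]) tE.
  by move=> h; rewrite !inE => /orP[] /eqP->.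
by have := s'h _ (mem_head _ _); rewrite /map_atom /= !s's.
Qed.

Definition justified (G : {fset fact}) : Prop := exists E, nulls_justified E G.

Lemma chase_step_add_head t s G : inl t \in S -> instance_in s t.1 G ->
  ~ satisfied t s G -> justified G ->
  [/\ chase_step le S G (add_head t s G), is_fresh t s G
    & justified (add_head t s G)].
Proof.
move=> tS sb nsat jG; have app : applicable (inl t) s G by [].
split; last 1 first.
- by case: jG => E EG; eexists; exact: nulls_justified_tgd EG app.
- by exists (inl t), s.
- exact: nulls_justified_fresh.
Qed.

(** Every step adds at least one missing [EQ] fact over the terms of [G], and there are finitely
    many of these. *)
Lemma saturate g G F : hom g G F -> justified G ->
  exists n G', [/\ chase_steps le S n G G', {subset G <= G'},
    {subset fact_terms G' <= fact_terms G}, hom g G' F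
    & justified G' /\ eq_closed G'].
Proof.
pose U := [seq (EQ, [:: u; v]) | u <- fact_terms G, v <- fact_terms G].
suff H c G1 : count (fun a => a \notin G1) U < c ->
    {subset fact_terms G1 <= fact_terms G} -> hom g G1 F -> justified G1 ->
  exists n G', [/\ chase_steps le S n G1 G', {subset G1 <= G'},
    {subset fact_terms G' <= fact_terms G}, hom g G' F
    & justified G' /\ eq_closed G'].
  by move=> hg jG; exact: H (ltnSn _) _ hg jG.
elim: c G1 => // c IH G1; rewrite ltnS => cnt sub hg jG.
have [cG|] := EM (eq_closed G1); first by exists 0, G1; split.
case/existsNP => t /existsNP[s /not_implyP[tE /not_implyP[sb nsat]]].
have [st _ jG'] := chase_step_add_head (eq_rules_S tE) sb nsat jG.
have head_body h v : h \in t.2 -> v \in h.2 -> v \in conj_vars t.1.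
  move=> ht; have [x [y [xb yb ->]]] := eq_rules_head tE ht.
  by rewrite !inE => /orP[] /eqP->.
have skh h : h \in t.2 -> map_atom (skolem_ext t s) h = map_atom s h.
  move=> ht; apply: eq_in_map_atom => v vh; apply: skolem_ext_body.
  exact: head_body ht vh.
have sub' : {subset fact_terms (add_head t s G1) <= fact_terms G}.
  move=> u /terms_add_head[/sub//|[v /conj_varsP[h ht vh] ->]].
  have vb := head_body h v ht vh; rewrite skolem_ext_body //.
  exact/sub/(instance_terms sb vb).
have hg' : hom g (add_head t s G1) F.
  move=> a /add_headP[/hg//|[h ht ->]].
  rewrite skh // map_atom_comp; exact: eq_rules_sound hg tE sb h ht.
(* If all instantiated head atoms were present, [s] itself would satisfy the rule. *)
have [h ht hG1] : exists2 h, h \in t.2 & map_atom s h \notin G1.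
  apply: contrapT => no; apply: nsat; exists s; split=> // h ht.
  by apply: contrapT => /negP hG1; apply: no; exists h.
have [|//|//|//|n [G' [sts sG' s2 h2 jc]]] := IH (add_head t s G1).
  apply: leq_trans cnt; apply: (ltn_count (z := map_atom s h)) => //.
  - by move=> a; apply: contra => /sub_add_head; apply.
  - have [x [y [xb yb ->]]] := eq_rules_head tE ht.
    by apply: (allpairs_f (fun u v => (EQ, [:: u; v]))); apply: sub; apply: instance_terms sb _.
  - by rewrite negbK; apply/add_headP; right; exists h => //; rewrite skh.
exists n.+1, G'; split=> //; first by exists (add_head t s G1).
by move=> a aG; apply/sG'/sub_add_head.
Qed.

(** * Singularised rules and simulation states *)

Definition rule_head (r : rule) : conjunction :=
  match r with
  | inl t => t.2
  | inr e => [:: (EQ, [:: e.2.1; e.2.2])]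
  end.

Definition tgd_of (r : rule) (t : tgd) : Prop :=
  exists keep fresh, sing_choice keep fresh (body r) (rule_vars r) /\
                     t = (sing_conj EQ keep fresh (body r), rule_head r).

Lemma body_vars_sub (r : rule) : {subset conj_vars (body r) <= rule_vars r}.
Proof. by case: r => [t|e] v vb //=; rewrite mem_cat vb. Qed.

Lemma body_preds r a : r \in R -> a \in body r -> a.1 \in preds R.
Proof.
move=> rR ab; apply/flatten_mapP; exists r => //.
by case: r ab {rR} => [t|e] /= ab; rewrite ?mem_cat map_f.
Qed.

Lemma head_preds t a : inl t \in R -> a \in t.2 -> a.1 \in preds R.
Proof.
move=> tR ah; apply/flatten_mapP; exists (inl t) => //=.
by rewrite mem_cat; apply/orP; right; exact: map_f.
Qed.

Lemma tgd_of_body r t g (s : subst) G F : r \in R -> tgd_of r t -> hom g G F ->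
  instance_in s t.1 G -> instance_in (g \o s) (body r) F.
Proof.
move=> rR [keep [fresh [_ ->]]] hg /= sb a ab.
apply: (@holds_pred _ (map_atom (g \o s) a)); last exact: body_preds rR ab.
apply: (unsing (EQ := EQ) (keep := keep) (fresh := fresh)
  (P := holds F) _ _ ab) => [u v /holds_EQ[]//|h hb].
by rewrite -map_atom_comp; apply/hg/sb.
Qed.

Lemma tgd_of_sub r t : tgd_of r t -> {subset conj_vars (body r) <= conj_vars t.1}.
Proof.
by move=> [keep [fresh [ch ->]]] v; exact: (sub_sing_conj_vars EQ ch).
Qed.

(** The fresh variables avoid the whole rule, head included, so singularising a body shares no
    renamed variable with the head. *)
Lemma tgd_of_frontier r t v : wf_rule r -> tgd_of r t ->
  v \in conj_vars t.1 -> v \in conj_vars t.2 -> v \in conj_vars (body r).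
Proof.
move=> wf [keep [fresh [ch ->]]] /(sing_conj_varsP ch)[//|] /negP va vh.
case: r wf ch va vh => [t'|[b [x y]]] /= wf _ va; last first.
  case/and3P: wf => _ xb yb.
  by rewrite /conj_vars /= !inE => /orP[] /eqP->.
by move=> vh; case: va; rewrite mem_cat vh orbT.
Qed.

(* The terms in [C] were introduced along with the simulated chase: they cover
   all of [F], and [EQ] identifies them exactly as [g] does. The other ones are
   nulls that only the singularised chase has to introduce. *)
Record simulates (F G : {fset fact}) (g : term -> term) (C : term -> Prop) : Prop :=
  Simulates {
    sim_justified : justified G;
    sim_hom : hom g G F;
    sim_lift : forall a, a \in F -> a.1 \in preds R ->
      exists b, [/\ b \in G, map_atom g b = a & forall u, u \in b.2 -> C u];
    sim_core : forall u, C u -> u \in fact_terms G;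
    sim_eq : forall u v, C u -> C v -> g u = g v -> (EQ, [:: u; v]) \in G }.

(** Each body fact lifts to a fact over the core. The [EQ] atoms produced by [lift_match] relate
    core terms with equal images, and [sim_eq] provides these facts. *)
Lemma sim_match F G g C r t (s : subst) :
  simulates F G g C -> r \in R -> tgd_of r t -> instance_in s (body r) F ->
  exists s' : subst, [/\ {in conj_vars (body r), g \o s' =1 s},
    forall v, v \in conj_vars t.1 -> C (s' v) & instance_in s' t.1 G].
Proof.
move=> sim rR [keep [fresh [ch ->]]] /= sb.
have [L Ls LG] : exists2 L, map (map_atom g) L = map (map_atom s) (body r) &
    forall a, a \in L -> a \in G /\ forall u, u \in a.2 -> C u.
  have bR a : a \in body r -> a.1 \in preds R by exact: body_preds.
  elim: (body r) sb bR => [|a b IH] sb bR; first by exists [::].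
  have [h hb|h hb|L Ls LG] := IH.
  - by apply: sb; rewrite inE hb orbT.
  - by apply: bR; rewrite inE hb orbT.
  have ab : a \in a :: b by rewrite mem_head.
  have [c [cG cs cC]] := sim_lift sim (sb a ab) (bR a ab).
  exists (c :: L); first by rewrite /= cs Ls.
  by move=> h; rewrite inE => /orP[/eqP->|/LG].
have CL u : u \in flatten (unzip2 L) -> C u.
  by case/flatten_mapP => a /LG[_ aC] /aC.
have [s' [gs' s'L s'b]] := lift_match EQ ch (@body_vars_sub r) Ls.
exists s'; split=> // [v /s'L/CL //|a /s'b[/LG[]//|[u [v [uL vL guv ->]]]]].
by apply: (sim_eq sim) => //; exact: CL.
Qed.

(* One more application of [t], where [F] provides the value of its nulls. *)
Lemma sim_apply F G g C t (s : subst) :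
  simulates F G g C -> inl t \in S ->
  exists n G' g', [/\ chase_steps le S n G G', {subset G <= G'},
    {in fact_terms G, g' =1 g}, simulates F G' g' C
    & instance_in s t.1 G -> head_holds F t (g \o s) -> satisfied t s G'].
Proof.
move=> sim tS.
have [H|nH] := EM (instance_in s t.1 G -> head_holds F t (g \o s) -> satisfied t s G).
  by exists 0, G, g; split.
case/not_implyP: nH => sb /not_implyP[[s' s's s'h] nsat].
have [st fresh jG'] := chase_step_add_head tS sb nsat (sim_justified sim).
have [g' [g'g g's hg']] := extend_hom (sim_hom sim) fresh sb s's s'h.
have GG' := @sub_add_head t s G.
(* The core [C] is kept: the new nulls stay outside it, so no [EQ] facts are owed for them, even if
   [g'] identifies them with other terms. *)
exists 1, (add_head t s G), g'; split=> //; first by exists (add_head t s G).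
  split=> //.
  - move=> a aF aR; have [b [bG ba bC]] := sim_lift sim aF aR.
    exists b; split=> //; first exact: GG'.
    rewrite -ba; apply: eq_in_map_atom => u ub; apply: g'g.
    by apply/fact_termsP; exists b.
  - by move=> u /(sim_core sim); exact: fact_terms_sub.
  - move=> u v uC vC; rewrite !g'g; try exact: (sim_core sim).
    by move=> guv; apply/GG'/(sim_eq sim).
by move=> _ _; exact: satisfied_add_head.
Qed.

(** The state between a mirrored step and the following saturation: the [EQ] facts over the core are
    only promised for equality-closed extensions. *)
Definition presimulates (F G : {fset fact}) (g : term -> term) (C : term -> Prop) : Prop :=
  [/\ justified G, hom g G F,
      forall a, a \in F -> a.1 \in preds R ->
        exists b, [/\ b \in G, map_atom g b = a & forall u, u \in b.2 -> C u],
      forall u, C u -> u \in fact_terms G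
    & forall u v, C u -> C v -> g u = g v ->
        forall G', {subset G <= G'} -> eq_closed G' -> (EQ, [:: u; v]) \in G'].

Lemma presim_saturate F G g C : presimulates F G g C ->
  exists n G', [/\ chase_steps le S n G G', {subset G <= G'},
    eq_closed G' & simulates F G' g C].
Proof.
case=> jG hg lift core eqG.
have [n [G' [sts GG' _ hg' [jG' cG']]]] := saturate hg jG.
exists n, G'; split=> //; split=> //.
- move=> a aF aR; have [b [bG ba bC]] := lift a aF aR.
  by exists b; split=> //; exact: GG'.
- by move=> u /core; exact: fact_terms_sub.
- by move=> u v uC vC guv; exact: (eqG u v uC vC guv).
Qed.

(** The lifted match is applied in [G]; its nulls are sent to those just created in [F], and they
    join the core so that the new facts can be lifted. *)
Lemma sim_step_tgd F G g C t t' (s : subst) :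
  {in F, forall a, wf_atom a} -> justified F ->
  simulates F G g C -> inl t \in R -> tgd_of (inl t) t' -> inl t' \in S ->
  applicable (inl t) s F ->
  exists G' g' C', [/\ chase_step le S G G', {subset G <= G'},
    {in fact_terms G, g' =1 g} & presimulates (add_head t s F) G' g' C'].
Proof.
move=> wfF jF sim tR t't t'S app; have [/= sb nsat] := app.
have [s' [gs' s'C s'b]] := sim_match sim tR t't sb.
have t'2 : t'.2 = t.2 by case: t't => keep [fresh [_ ->]].
have hg := sim_hom sim.
(* Otherwise [g] would carry the satisfied head over to [F]. *)
have nsat' : ~ satisfied t' s' G.
  case=> s1 [s1s' s1h]; apply: nsat; exists (g \o s1); split=> [v vb|a ah].
    by rewrite /= s1s' ?(tgd_of_sub t't) // -gs'.
  apply: (@holds_pred _ (map_atom (g \o s1) a)); last exact: head_preds tR ah.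
  by rewrite -map_atom_comp; apply/hg/s1h; rewrite t'2.
have [st fresh jG'] := chase_step_add_head t'S s'b nsat' (sim_justified sim).
have FF' := @sub_add_head t s F.
have hgF' : hom g G (add_head t s F).
  move=> a /hg[[aR aF]|[u uF ->]]; first by left; split=> //; exact: FF'.
  by right; exists u => //; exact: fact_terms_sub uF.
have s'f : {in frontier t', skolem_ext t s =1 g \o s'}.
  move=> v; rewrite mem_frontier => /andP[vh vb].
  have vtb := tgd_of_frontier (R_wf tR) t't vb vh.
  by rewrite skolem_ext_body // gs'.
have [|g' [g'g g's hg']] := extend_hom hgF' fresh s'b s'f.
  move=> a; rewrite t'2 => ah; left; split; first exact: head_preds tR ah.
  exact: instance_add_head.
pose G' := add_head t' s' G.
have GG' : {subset G <= G'} := @sub_add_head t' s' G.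
pose new u := exists v, [/\ v \in conj_vars t.2, v \notin conj_vars t.1
                          & u = skolem_ext t' s' v].
(* The nulls created in [F] are fresh there, hence not images of old core terms, so no equality
   between old and new core terms has to be derived. *)
have new_fresh u v : C u -> new v -> g' u != g' v.
  move=> uC [w [wh wb ->]]; rewrite g'g; last exact: (sim_core sim uC).
  have -> : g' (skolem_ext t' s' w) = skolem_ext t s w by apply: g's; rewrite t'2.
  apply: contraNneq (nulls_justified_fresh jF app w) => e.
  have -> : Sk (t, w) (map s (frontier t)) = g u.
    by rewrite e /skolem_ext (negPf wb).
  by apply: hom_terms hg _; exact: (sim_core sim uC).
exists G', g', (fun u => C u \/ new u); split=> //.
split=> //.
- move=> a /add_headP[aF|[h ht ->]] aR.
    have [b [bG ba bC]] := sim_lift sim aF aR.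
    exists b; split; [exact: GG' | | by move=> u /bC; left].
    rewrite -ba; apply: eq_in_map_atom => u ub; apply: g'g.
    by apply/fact_termsP; exists b.
  exists (map_atom (skolem_ext t' s') h); split.
  - by apply: instance_add_head; rewrite t'2.
  - rewrite map_atom_comp; apply: eq_in_map_atom => v vh; apply: g's.
    by rewrite t'2; exact: mem_conj_vars ht vh.
  - move=> u /mapP[v vh ->]; case: (boolP (v \in conj_vars t.1)) => vb.
      left; rewrite skolem_ext_body; last exact: (tgd_of_sub t't).
      by apply: s'C; exact: (tgd_of_sub t't).
    by right; exists v; split=> //; exact: mem_conj_vars ht vh.
- move=> u [/(sim_core sim)|[v [/conj_varsP[h ht vh] _ ->]]].
    exact: fact_terms_sub.
  apply/fact_termsP; exists (map_atom (skolem_ext t' s') h); last exact: map_f.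
  by apply: instance_add_head; rewrite t'2.
- move=> u v [uC|un] [vC|vn].
  + rewrite !g'g; try exact: (sim_core sim).
    by move=> guv G2 G'2 _; apply/G'2/GG'/(sim_eq sim).
  + by move/eqP; rewrite (negPf (new_fresh _ _ uC vn)).
  + by move/esym/eqP; rewrite (negPf (new_fresh _ _ vC un)).
  (* Two new nulls with the same image stem from the same existential variable, so they coincide and
     reflexivity suffices. *)
  case: un vn => [w [wh wb ->]] [w' [w'h w'b ->]].
  have g'new z : z \in conj_vars t.2 -> g' (skolem_ext t' s' z) = skolem_ext t s z.
    by move=> zh; apply: g's; rewrite t'2.
  rewrite !g'new // {1 2}/skolem_ext (negPf wb) (negPf w'b) => -[<-] G2 G'2 cG2.
  case/conj_varsP: wh => h ht wh.
  apply: (eq_closed_refl (a := map_atom (skolem_ext t' s') h)) => //.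
  + by apply/G'2/instance_add_head; rewrite t'2.
  + exact: head_preds tR ht.
  + have /andP[_ /andP[_ /allP/(_ h ht)]] := R_wf tR.
    by rewrite /wf_atom size_map.
  + exact: map_f.
Qed.

(** Merging becomes one new [EQ] fact. No core term is added; core terms that become identified are
    linked through [s' x] and [s' y] by symmetry and transitivity. The pair [p], [q] leaves the
    direction of the merge open. *)
Lemma sim_step_egd F G g C b x y t (s : subst) p q :
  simulates F G g C -> inr (b, (x, y)) \in R -> tgd_of (inr (b, (x, y))) t ->
  inl t \in S -> applicable (inr (b, (x, y))) s F ->
  (p, q) = (s x, s y) \/ (p, q) = (s y, s x) ->
  exists G', [/\ chase_step le S G G', {subset G <= G'}
    & exists2 g', {in fact_terms G, g' =1 rename_term p q \o g} &
        presimulates (replace_term p q F) G' g' C].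
Proof.
move=> sim rR tr tS [/= sb nxy] pq.
have [s' [gs' s'C s'b]] := sim_match sim rR tr sb.
have /and3P[/= _ xb yb] := R_wf rR.
have t2 : t.2 = [:: (EQ, [:: x; y])] by case: tr => keep [fresh [_ ->]].
have hg := sim_hom sim; pose rho := rename_term p q.
have [xt yt] : x \in conj_vars t.1 /\ y \in conj_vars t.1.
  by split; exact: (tgd_of_sub tr).
have nsat : ~ satisfied t s' G.
  case=> s1 [s1s' s1h]; apply: nxy.
  have /hg/holds_EQ[] : map_atom s1 (EQ, [:: x; y]) \in G.
    by apply: s1h; rewrite t2 mem_head.
  by rewrite !s1s' // -[s x]gs' // -[s y]gs'.
have [st fresh jG'] := chase_step_add_head tS s'b nsat (sim_justified sim).
have rhoF u : u \in fact_terms F -> rho u \in fact_terms (replace_term p q F).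
  case/fact_termsP => a aF ua; apply/fact_termsP.
  by exists (map_atom rho a); [exact: map_replace | exact: map_f].
have hrho : hom (rho \o g) G (replace_term p q F).
  move=> a /hg H; rewrite -map_atom_comp; case: H => [[aR aF]|[u uF ->]].
    by left; split=> //; exact: map_replace.
  by right; exists (rho u) => //; exact: rhoF.
have rho_xy : rho (s x) = rho (s y).
  rewrite /rho /rename_term; case: pq => -[-> ->]; rewrite eqxx; by case: ifP => // /eqP.
(* The renaming collapses nothing but the two merged terms. *)
have rho_inv u v : rho u = rho v -> u = v \/
    (u = s x /\ v = s y) \/ (u = s y /\ v = s x).
  rewrite /rho /rename_term; case: eqP => eu; case: eqP => ev; move=> e.
  - by left; congruence.
  - by right; case: pq => -[ep eq]; [left|right]; split; congruence.
  - by right; case: pq => -[ep eq]; [right|left]; split; congruence.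
  - by left.
have [//||g' [g'g g's hg']] := extend_hom hrho fresh s'b (s' := rho \o g \o s').
  move=> a; rewrite t2 inE => /eqP->; right; exists (rho (s x)).
    by apply: rhoF; exact: instance_terms sb xb.
  by rewrite /map_atom /= -/((g \o s') x) -/((g \o s') y) !gs' // -rho_xy.
have GG' := @sub_add_head t s' G.
exists (add_head t s' G); split=> //; exists g' => //; split=> //.
- move=> _ /replace_termP[a aF ->] aR; have [c [cG ca cC]] := sim_lift sim aF aR.
  exists c; split=> //; first exact: GG'.
  rewrite -ca map_atom_comp; apply: eq_in_map_atom => u uc; apply: g'g.
  by apply/fact_termsP; exists c.
- by move=> u /(sim_core sim); exact: fact_terms_sub.
move=> u v uC vC; rewrite !g'g; try exact: (sim_core sim).
move=> /rho_inv guv G2 G'2 cG2.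
have GG2 a : a \in G -> a \in G2 by move=> aG; apply/G'2/GG'.
have xyG2 : (EQ, [:: s' x; s' y]) \in G2.
  apply: G'2; have := instance_add_head (t := t) s' G; rewrite t2 => /(_ _ (mem_head _ _)).
  by rewrite /map_atom /= !skolem_ext_body.
have eqC w z : C w -> z \in conj_vars b -> g w = s z -> (EQ, [:: w; s' z]) \in G2.
  move=> wC zb e; apply: GG2; apply: (sim_eq sim) => //.
    by apply: s'C; exact: (tgd_of_sub tr).
  by rewrite e -gs'.
case: guv => [guv|[[gu gv]|[gu gv]]].
- exact/GG2/(sim_eq sim).
- apply: eq_closed_trans (eqC u x uC xb gu) _ => //.
  apply: eq_closed_trans xyG2 _ => //.
  by apply: eq_closed_sym => //; exact: eqC.
apply: eq_closed_trans (eqC u y uC yb gu) _ => //.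
apply: eq_closed_trans (eq_closed_sym cG2 xyG2) _ => //.
by apply: eq_closed_sym => //; exact: eqC.
Qed.

Hypothesis S_tgd_of : forall r, r \in R -> exists2 t, tgd_of r t & inl t \in S.

(* Before mirroring the step of [R], a match for [t0] is dealt with, for the
   sake of fairness. *)
Lemma sim_step F G g C r s t0 s0 :
  {in F, forall a, wf_atom a} -> justified F -> simulates F G g C ->
  r \in R -> applicable r s F ->
  let F' := apply_rule le r s F in
  exists n G' g' C' rho, [/\ chase_steps le S n.+1 G G',
    {subset G <= G'} /\ eq_closed G', simulates F' G' g' C',
    [/\ {in fact_terms G, g' =1 rho \o g}, forall u, le (rho u) u
      & forall a, a \in F -> map_atom rho a \in F']
    & inl t0 \in S -> instance_in s0 t0.1 G -> head_holds F t0 (g \o s0) ->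
      satisfied t0 s0 G'].
Proof.
move=> wfF jF sim rR app F'.
have [n1 [G1 [g1 [sts1 GG1 g1g sim1 sat1]]]] :
  exists n G' g', [/\ chase_steps le S n G G', {subset G <= G'},
    {in fact_terms G, g' =1 g}, simulates F G' g' C
    & inl t0 \in S -> instance_in s0 t0.1 G -> head_holds F t0 (g \o s0) ->
      satisfied t0 s0 G'].
  have [t0S|t0S] := boolP (inl t0 \in S); last by exists 0, G, g; split.
  have [n [G' [g' [? ? ? ? sat]]]] := sim_apply s0 sim t0S.
  by exists n, G', g'; split.
have [G2 [g2 [C2 [rho [st2 GG2 pre2 [g2g le_rho rhoF]]]]]] :
  exists G' g' C' rho, [/\ chase_step le S G1 G', {subset G1 <= G'},
    presimulates F' G' g' C' & [/\ {in fact_terms G1, g' =1 rho \o g1},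
      forall u, le (rho u) u & forall a, a \in F -> map_atom rho a \in F']].
  (* The map [rho] tracks what the step does to the terms of [F]: the identity for a TGD, the
     [le]-decreasing renaming for an EGD. *)
  have [t tr tS] := S_tgd_of rR; rewrite {}/F'.
  case: r rR app tr => [t1|[b [x y]]] rR app tr /=.
    have [G' [g' [C' [st GG' g'g pre]]]] := sim_step_tgd wfF jF sim1 rR tr tS app.
    exists G', g', C', id; split=> //; split=> // a aF.
    by rewrite map_atom_id_in //; exact: sub_add_head.
  have [p [q [pq le_qp ->]]] := merge_termsP (s x) (s y) F le_total.
  have [G' [st GG' [g' g'g pre]]] := sim_step_egd sim1 rR tr tS app pq.
  exists G', g', C, (rename_term p q); split=> //; split=> //.
    by move=> u; rewrite /rename_term; case: eqP => [->|].
  exact: map_replace.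
have [n3 [G3 [sts3 GG3 cG3 sim3]]] := presim_saturate pre2.
have G13 a : a \in G1 -> a \in G3 by move=> /GG2/GG3.
(* The mirrored step accounts for the successor in [n.+1]. It ensures progress at every round and
   thereby an infinite simulating chase. *)
exists (n1 + n3), G3, g2, C2, rho; split=> //.
- rewrite -addnS; apply: chase_steps_trans sts1 _; by exists G2.
- by split=> // a /GG1/G13.
- split=> // u uG; rewrite g2g /=; last exact: fact_terms_sub uG.
  by rewrite g1g.
by move=> tS sb hh; exact: satisfied_sub G13 (sat1 tS sb hh).
Qed.

(** * Heads that hold in the simulated chase *)

Lemma eq_head_holds F t (s s' : subst) :
  {in frontier t, s' =1 s} -> head_holds F t s -> head_holds F t s'.
Proof. by move=> ss' [s1 s1s s1h]; exists s1 => // v vf; rewrite s1s ?ss'. Qed.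

(** With the body matched, only the head can block the rule: a TGD head already has an extension in
    [F], and the two sides of an EGD already coincide. *)
Lemma inapplicable_head_holds r t (s : subst) F : r \in R -> tgd_of r t ->
  instance_in s (body r) F -> ~ applicable r s F -> head_holds F t s.
Proof.
move=> rR tr sb napp; have t2 : t.2 = rule_head r by case: tr => ? [? [_ ->]].
have bodyP v : v \in frontier t -> v \in conj_vars (body r).
  rewrite mem_frontier => /andP[vh vb]; exact: tgd_of_frontier (R_wf rR) tr vb vh.
case: r rR {tr} sb napp t2 bodyP => [t1|[b [x y]]] rR sb napp t2 bodyP.
  have [s' [s's s'h]] : exists s', {in conj_vars t1.1, s' =1 s} /\ instance_in s' t1.2 F.
    by apply: contrapT => nsat; exact: napp.
  exists s' => [v /bodyP/s's //|a]; rewrite t2 => ah; left.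
  by split; [exact: head_preds rR ah | exact: s'h].
exists s => // a; rewrite t2 inE => /eqP->; right; exists (s x).
  by apply: instance_terms sb _; have /and3P[] := R_wf rR.
rewrite /map_atom /=; congr (_, [:: _; _]).
by apply: contrapT => nxy; apply: napp; split=> // e; exact: nxy.
Qed.

Lemma head_holds_map F F' rho t (s : subst) :
  (forall a, a \in F -> map_atom rho a \in F') ->
  head_holds F t s -> head_holds F' t (rho \o s).
Proof.
move=> rhoF [s' s's s'h]; exists (rho \o s') => [v /s's /= -> //|a /s'h].
rewrite -(map_atom_comp rho s') => -[[aR aF]|[u /fact_termsP[b bF ub] ->]].
  by left; split=> //; exact: rhoF.
right; exists (rho u) => //; apply/fact_termsP.
by exists (map_atom rho b); [exact: rhoF | exact: map_f].
Qed.

End Simulation.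

(** * Fairness of the simulating chase *)

Lemma dependent_choice (X : Type) (P : nat -> X -> Prop) (Q : nat -> X -> X -> Prop) x0 :
  P 0 x0 -> (forall n x, P n x -> exists2 y, P n.+1 y & Q n x y) ->
  exists x, [/\ x 0 = x0, forall n, P n (x n) & forall n, Q n (x n) (x n.+1)].
Proof.
move=> P0 PQ.
(* Guarding the relation by [P] makes it total, as choice requires. *)
have [p|f Hf] := @choice (nat * X) X
    (fun p y => P p.1 p.2 -> P p.1.+1 y /\ Q p.1 p.2 y).
  have [Pp|nPp] := EM (P p.1 p.2); last by exists p.2.
  by have [y] := PQ _ _ Pp; exists y.
pose x := fix x n := if n is m.+1 then f (m, x m) else x0.
have Px n : P n (x n) by elim: n => //= n IH; exact: (Hf (n, x n) IH).1.
by exists x; split=> // n; exact: (Hf (n, x n) (Px n)).2.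
Qed.

Lemma chase_steps_seq le S n G G' : chase_steps le S n G G' ->
  exists f, [/\ f 0 = G, f n = G' & forall i, i < n -> chase_step le S (f i) (f i.+1)].
Proof.
elim: n G => [|n IH] G /=; first by move=> ->; exists (fun=> G').
case=> G1 st /IH[f [f0 fn fst]].
exists (fun i => if i is j.+1 then f j else G); split=> // -[_|i /fst //].
by rewrite f0.
Qed.

(** The blocks of steps are concatenated, and [phi n] is the index at which block [n] starts. *)
Lemma chase_steps_flatten le S (G : nat -> {fset fact}) :
  (forall n, exists k, chase_steps le S k.+1 (G n) (G n.+1)) ->
  exists (H : nat -> {fset fact}) (phi : nat -> nat),
    [/\ H 0 = G 0, forall i, chase_step le S (H i) (H i.+1),
        forall n, H (phi n) = G n & forall n, n <= phi n].
Proof.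
move=> HG.
have [n|kf Hkf] := @choice _ (nat * (nat -> {fset fact}))
    (fun n kf => [/\ kf.2 0 = G n, kf.2 kf.1.+1 = G n.+1 &
      forall i, i <= kf.1 -> chase_step le S (kf.2 i) (kf.2 i.+1)]).
  by have [k /chase_steps_seq[f Hf]] := HG n; exists (k, f).
pose k n := (kf n).1; pose f n := (kf n).2.
(* Block [n] has [k n + 1] steps and occupies positions 0 to [k n]; its final fact set is counted as
   position 0 of the next block. *)
pose next p := if p.2 < k p.1 then (p.1, p.2.+1) else (p.1.+1, 0).
pose pos i := iter i next (0, 0).
pose H i := f (pos i).1 (pos i).2.
have pos_le i : (pos i).2 <= k (pos i).1.
  by elim: i => //= i IH; rewrite {1 2}/next -/(pos i); case: ifP.
pose phi := fix phi n := if n is m.+1 then (k m).+1 + phi m else 0.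
have pos_phi n : pos (phi n) = (n, 0).
  elim: n => // n IH; rewrite /pos iterD -/(pos _) IH.
  suff E j : j <= k n -> iter j next (n, 0) = (n, j) by rewrite iterS E // /next ltnn.
  by elim: j => // j IHj jk; rewrite iterS IHj 1?ltnW // /next jk.
exists H, phi; split.
- by have [] := Hkf 0.
- move=> i; rewrite /H /= -/(pos i) /next.
  have [f0 fk fst] := Hkf (pos i).1; have := pos_le i.
  case: ltnP => [lt le_k|ge le_k] /=; first exact: fst.
  have e : (pos i).2 = k (pos i).1 by apply/eqP; rewrite eqn_leq le_k.
  have [f0' _ _] := Hkf (pos i).1.+1.
  by rewrite /f f0' -fk e; exact: fst.
- by move=> n; rewrite /H pos_phi; have [] := Hkf n.
by elim=> // n IH /=; rewrite addSn ltnS (leq_trans IH) // leq_addl.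
Qed.

(* The 2-adic valuation takes every value infinitely often. *)
Definition task (n : nat) : tgd * seq term :=
  odflt ([::], [::], [::]) (choice.unpickle (logn 2 n)).

Lemma task_often (x : tgd * seq term) (m : nat) : exists2 n, m <= n & task n = x.
Proof.
(* The odd factor pushes the index beyond [m] without changing the valuation. *)
exists (2 ^ choice.pickle x * (2 * m).+1).
  by rewrite (leq_trans _ (leq_pmull _ _)) ?expn_gt0 // leqW // leq_pmull.
rewrite /task lognM ?expn_gt0 // pfactorK // (logn_coprime (m := _.+1)) ?addn0 ?choice.pickleK //.
by rewrite coprime2n /= oddM.
Qed.

Lemma wf_atom_step le r (s : subst) (F : {fset fact}) : total le -> wf_rule r ->
  {in F, forall a, wf_atom a} -> {in apply_rule le r s F, forall a, wf_atom a}.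
Proof.
move=> le_total; case: r => [t|[b [x y]]] wf wfF a /=.
  case/add_headP => [/wfF //|[h ht ->]].
  have /andP[_ /andP[_ /allP/(_ h ht)]] := wf.
  by rewrite /wf_atom size_map.
have [p [q [_ _ ->]]] := merge_termsP (s x) (s y) F le_total.
by case/replace_termP => c /wfF + ->; rewrite /wf_atom size_map.
Qed.

Lemma common_bound (T : eqType) (l : seq T) (m : nat) (P : T -> nat -> Prop) :
  (forall x, x \in l -> exists2 N, m <= N & forall n, N <= n -> P x n) ->
  exists2 N, m <= N & forall x n, x \in l -> N <= n -> P x n.
Proof.
elim: l => [|x l IH] H; first by exists m.
have [N mN HN] := H x (mem_head _ _).
have [|N' mN' HN'] := IH; first by move=> y yl; apply: H; rewrite inE yl orbT.
exists (maxn N N') => [|y n]; first by rewrite leq_max mN.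
rewrite inE geq_max => /orP[/eqP->|yl] /andP[Nn N'n]; first exact: HN.
exact: HN'.
Qed.

Section FairSimulation.
Variables (le : rel term) (EQ : predicate) (R S : {fset rule}).
Hypotheses (le_depth : depth_order le).
Hypotheses (EQ_fresh : EQ \notin preds R) (R_wf : wf_rules R).
Hypothesis S_rules : forall r, r \in S ->
  r \in eq_rules EQ R \/ exists r0 t, [/\ r0 \in R, tgd_of EQ r0 t & r = inl t].
Variable F : nat -> {fset fact}.
Hypothesis F_fair : forall i r s, r \in R -> applicable r s (F i) ->
  exists2 j, i < j & ~ applicable r s (F j).
Variable K : seq term.
Hypothesis F_sig : forall n, {in fact_terms (F n), forall u, over_sig R K u}.
Variables (G : nat -> {fset fact}) (g : nat -> term -> term) (rho : nat -> term -> term).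
Hypothesis G_sub : forall n, {subset G n <= G n.+1}.
Hypothesis G_closed : forall n, eq_closed EQ R (G n.+1).
Hypothesis g_hom : forall n, hom EQ R (g n) (G n) (F n).
Hypothesis g_rho : forall n, {in fact_terms (G n), g n.+1 =1 rho n \o g n}.
Hypothesis rho_le : forall n u, le (rho n u) u.
Hypothesis rho_hom : forall n a, a \in F n -> map_atom (rho n) a \in F n.+1.
Hypothesis G_task : forall n t sl, task n = (t, sl) -> inl t \in S ->
  instance_in (nth (Cst 0) sl) t.1 (G n) ->
  head_holds EQ R (F n) t (g n \o nth (Cst 0) sl) ->
  satisfied t (nth (Cst 0) sl) (G n.+1).

Lemma G_mono m n : m <= n -> {subset G m <= G n}.
Proof.
move=> /subnK<-; elim: (n - m) => // k IH a /IH aG.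
by rewrite addSn; exact: G_sub.
Qed.

(** The images of a fixed term of [G m] descend along [le], each being obtained from the previous
    one by [rho], and stay over the signature. Finitely many variables then admit a common bound. *)
Lemma images_stationary m (t : tgd) (s : subst) : instance_in s t.1 (G m) ->
  exists2 N, m <= N & forall v n, v \in conj_vars t.1 -> N <= n -> g n (s v) = g N (s v).
Proof.
move=> sb; have sG v n : v \in conj_vars t.1 -> m <= n -> s v \in fact_terms (G n).
  by move=> vb mn; apply: fact_terms_sub (G_mono mn) _ (instance_terms sb vb).
have [|N mN HN] := @common_bound _ (conj_vars t.1) m
    (fun v n => forall k, n <= k -> g k (s v) = g n (s v)); last first.
  by exists N => // v n vb Nn; exact: HN vb (leqnn N) n Nn.
move=> v vb.
have [n mn|n mn|N mN HN] := @descending_stationary R K le (fun n => g n (s v)) m le_depth.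
- apply: F_sig; apply: hom_terms (@g_hom n) _ => //; exact: sG.
- by rewrite g_rho ?sG //; exact: rho_le.
by exists N => // n Nn k nk; rewrite (HN k) ?(HN n) // (leq_trans Nn).
Qed.

(** Once the images are constant, they form one fixed body match of [r]. Fairness makes it
    inapplicable at some stage; its body still holds there, so its head does, and [rho] carries the
    head to all later stages. *)
Lemma head_eventually_holds m r (t : tgd) (s : subst) : r \in R -> tgd_of EQ r t ->
  instance_in s t.1 (G m) ->
  exists2 N, m <= N & forall n, N <= n -> head_holds EQ R (F n) t (g n \o s).
Proof.
move=> rR tr sb; have [N mN HN] := images_stationary sb.
pose sigma := g N \o s.
have [j Nj napp] : exists2 j, N <= j & ~ applicable r sigma (F j).
  have [/(F_fair rR)[j Nj napp]|napp] := EM (applicable r sigma (F N)).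
    by exists j => //; exact: ltnW.
  by exists N.
have sbn n : m <= n -> instance_in s t.1 (G n).
  by move=> mn; exact: instance_sub (G_mono mn) sb.
exists j => [|n /subnK<-]; first exact: leq_trans mN Nj.
elim: (n - j) => [|k IH].
  have sj : {in conj_vars t.1, g j \o s =1 sigma} by move=> v vb; rewrite /= HN.
  apply: (@eq_head_holds _ _ _ _ sigma).
    by move=> v; rewrite mem_frontier => /andP[_ /sj].
  apply: (inapplicable_head_holds R_wf rR tr _ napp).
  apply: (@eq_instance (g j \o s)).
    by move=> v /(tgd_of_sub tr)/sj.
  apply: (tgd_of_body EQ_fresh rR tr (@g_hom j)).
  exact: sbn (leq_trans mN Nj).
rewrite addSn; have mk : m <= k + j by rewrite (leq_trans mN) ?(leq_trans Nj) ?leq_addl.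
apply: eq_head_holds (head_holds_map (@rho_hom _) IH) => v.
rewrite mem_frontier => /andP[_ vb]; rewrite /= g_rho //.
exact: instance_terms (sbn _ mk) vb.
Qed.

Lemma simulation_fair m (t : tgd) (s : subst) : inl t \in S ->
  instance_in s t.1 (G m) -> exists2 n, m <= n & satisfied t s (G n).
Proof.
move=> tS sb; have [tE|[r [t' [rR tr [tt']]]]] := S_rules tS.
  by exists m.+1 => //; apply: G_closed => //; exact: instance_sub (@G_sub m) sb.
rewrite -{}tt' in tr; have [N mN HN] := head_eventually_holds rR tr sb.
(* Tasks must be countable, so the match is truncated to a finite list that reaches the largest body
   variable. *)
pose sl := mkseq s (\max_(v <- conj_vars t.1) v).+1.
have sls : {in conj_vars t.1, nth (Cst 0) sl =1 s}.
  by move=> v vb; rewrite nth_mkseq // ltnS (big_rem v) //= leq_maxl.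
(* The task is taken up at a round after [N], when [F n] offers values for the head. *)
have [n Nn tn] := task_often (t, sl) N.
exists n.+1; first by rewrite leqW // (leq_trans mN).
have [|| s' [s's s'h]] := G_task tn tS.
- by apply: eq_instance sls _; exact: instance_sub (G_mono (leq_trans mN Nn)) sb.
- apply: eq_head_holds (HN n Nn) => v; rewrite mem_frontier => /andP[_ vb].
  by rewrite /= sls.
by exists s'; split=> // v vb; rewrite s's // sls.
Qed.

End FairSimulation.

(** * Construction of the fair infinite chase *)

Lemma mem_Sing EQ R (c : rule -> rule) r :
  (r \in ([fset c r | r in R]
     `|` [fset r in [seq refl_rule EQ P | P <- preds R & 0 < arity P]]
     `|` [fset sym_rule EQ; trans_rule EQ])%fset) =
  (r \in [fset c r | r in R]%fset) || (r \in eq_rules EQ R).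
Proof.
rewrite mem_cat orbA in_fsetU in_fsetU; congr (_ || _).
  by congr (_ || _); rewrite inE.
by rewrite in_fset2 in_cons mem_seq1.
Qed.

Theorem theorem3 (le : rel term) (le_depth : depth_order le)
    (EQ : predicate) (EQ_binary : arity EQ = 2)
    (R : {fset rule}) (R_wf : wf_rules R) (EQ_fresh : EQ \notin preds R) :
  (exists S : {fset rule}, Sing EQ R S /\ chase_terminates le S) ->
  chase_terminates le R.
Proof.
case=> S [[c [singR defS]] termS] F0 F0_facts [n|] F; first by exists n.
case=> F_0 F_step F_fair; exfalso.
have [le_refl _ _ le_total _] := le_depth.
have singP r : r \in R -> exists2 t, tgd_of EQ r t & c r = inl t.
  case/singR => b' [keep [fresh [ch ->]]] ->.
  by case: r ch => [t|e] ch; eexists; try by []; exists keep, fresh.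
have mem_S r : (r \in S) =
    (r \in [fset c r | r in R]%fset) || (r \in eq_rules EQ R).
  by rewrite defS; exact: mem_Sing.
have eq_rules_S : {subset eq_rules EQ R <= S} by move=> r rE; rewrite mem_S rE orbT.
have S_tgd_of r : r \in R -> exists2 t, tgd_of EQ r t & inl t \in S.
  move=> rR; have [t tr crt] := singP r rR; exists t => //.
  by rewrite mem_S -crt in_imfset.
have S_rules r : r \in S ->
    r \in eq_rules EQ R \/ exists r0 t, [/\ r0 \in R, tgd_of EQ r0 t & r = inl t].
  rewrite mem_S => /orP[/imfsetP[r0 /= r0R ->]|]; last by left.
  by right; have [t tr crt] := singP r0 r0R; exists r0, t.
have S_tgd r : r \in S -> exists t, r = inl t.
  case/S_rules => [|[r0 [t [_ _ ->]]]]; last by exists t.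
  rewrite mem_cat in_cons mem_seq1 => /orP[/mapP[p _ ->]|/orP[] /eqP->]; by eexists.
have F_inv n : [/\ {in F n, forall a, wf_atom a}, justified (F n)
    & {in fact_terms (F n), forall u, over_sig R (fact_terms F0) u}].
  elim: n => [|n [wfF jF sigF]].
    rewrite F_0; split=> [a /F0_facts/andP[]//||u uF].
      exact: nulls_justified_constants.
    have /fact_termsP[a /F0_facts/andP[_ /allP ac] /ac] := uF.
    by case: u uF.
  have [r [s [rR app ->]]] := F_step n isT; split.
  - exact: wf_atom_step (R_wf _ rR) wfF.
  - exact: nulls_justified_step (R_wf _ rR) app jF.
  - exact: over_sig_step (R_wf _ rR) app sigF.
(* Facts over other predicates are dropped, as [holds] does not admit them. The reflexive [EQ] facts
   keep all initial terms present, so these can form the initial core, with the identity as the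
   map. *)
pose G0 := ([fset a in [seq a <- enum_fset F0 | a.1 \in preds R]]
  `|` [fset a in [seq (EQ, [:: u; u]) | u <- fact_terms F0]])%fset.
have G0P a : a \in G0 -> (a \in F0 /\ a.1 \in preds R) \/
    exists2 u, u \in fact_terms F0 & a = (EQ, [:: u; u]).
  rewrite !inE /= mem_filter => /orP[/andP[aR aF]|/mapP]; first by left.
  by right.
have G0_eq u : u \in fact_terms F0 -> (EQ, [:: u; u]) \in G0.
  by move=> uF; rewrite !inE /=; apply/orP; right; apply/mapP; exists u.
have G0_facts : fact_set G0.
  move=> a /G0P[[/F0_facts //]|[u /fact_termsP[b /F0_facts/andP[_ /allP bc] /bc uc] ->]].
  by rewrite /wf_atom /= uc EQ_binary.
(* A state consists of the fact set, the map to the simulated chase and the core. *)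
pose state := ({fset fact} * (term -> term) * (term -> Prop))%type.
pose P n (x : state) := simulates EQ R (F n) x.1.1 x.1.2 x.2.
pose Q n (x y : state) (krho : nat * (term -> term)) :=
  let: (k, rho) := krho in [/\ chase_steps le S k.+1 x.1.1 y.1.1,
  {subset x.1.1 <= y.1.1} /\ eq_closed EQ R y.1.1,
  [/\ {in fact_terms x.1.1, y.1.2 =1 rho \o x.1.2}, forall u, le (rho u) u
    & forall a, a \in F n -> map_atom rho a \in F n.+1]
  & forall t sl, task n = (t, sl) -> inl t \in S ->
      instance_in (nth (Cst 0) sl) t.1 x.1.1 ->
      head_holds EQ R (F n) t (x.1.2 \o nth (Cst 0) sl) ->
      satisfied t (nth (Cst 0) sl) y.1.1].
have P0 : P 0 (G0, id, fun u => is_true (u \in fact_terms F0)).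
  rewrite /P F_0; split=> /=.
  - exact: nulls_justified_constants.
  - move=> a /G0P[[aF aR]|[u uF ->]]; last by right; exists u.
    by left; rewrite map_atom_id_in.
  - move=> a aF aR; exists a; split; last by move=> u ua; apply/fact_termsP; exists a.
      by rewrite !inE /= mem_filter aR aF.
    exact: map_atom_id_in.
  - move=> u uF; apply/fact_termsP; exists (EQ, [:: u; u]); first exact: G0_eq.
    exact: mem_head.
  - by move=> u v uF _ <-; exact: G0_eq.
have [n [[G g] C] /= sim|x [x0 Px Qx]] := 
  @dependent_choice state P (fun n x y => exists p, Q n x y p) _ P0.
  have [r [s [rR app FS]]] := F_step n isT.
  have [wfF jF _] := F_inv n; case tn : (task n) => [t sl].
  have [k [G' [g' [C' [rho [sts sub sim' rhoP sat]]]]]] :=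
    sim_step le_refl le_total EQ_fresh R_wf eq_rules_S S_tgd_of
      t (nth (Cst 0) sl) wfF jF sim rR app.
  exists (G', g', C'); first by rewrite /P FS.
  exists (k, rho); split=> //=; first by rewrite FS.
  by move=> t1 sl1; rewrite tn => -[<- <-].
have [p Qp] := choice Qx.
have st n : chase_steps le S (p n).1.+1 (x n).1.1 (x n.+1).1.1.
  by have := Qp n; case: (p n) => k rho [].
have G_sub n : {subset (x n).1.1 <= (x n.+1).1.1}.
  by have := Qp n; case: (p n) => k rho [_ []].
have fair := @simulation_fair le EQ R S le_depth EQ_fresh R_wf S_rules F _
  (fact_terms F0) _ (fun n => (x n).1.1) (fun n => (x n).1.2) (fun n => (p n).2).
have {}fair m t s : inl t \in S -> instance_in s t.1 (x m).1.1 ->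
    exists2 n, m <= n & satisfied t s (x n).1.1.
  apply: fair => //.
  - by move=> i r s0 rR /(F_fair i r s0 isT rR)[j [ij _ napp]]; exists j.
  - by move=> n; have [] := F_inv n.
  - by move=> n; have := Qp n; case: (p n) => k rho [_ []].
  - by move=> n; exact: sim_hom (Px n).
  - by move=> n; have := Qp n; case: (p n) => k rho [_ _ []].
  - by move=> n; have := Qp n; case: (p n) => k rho [_ _ []].
  - by move=> n; have := Qp n; case: (p n) => k rho [_ _ []].
  - by move=> n; have := Qp n; case: (p n) => k rho [_ _ _].
have [n|H [phi [H0 H_step Hphi phi_ge]]] :=
  @chase_steps_flatten le S (fun n => (x n).1.1); first by exists (p n).1.
(* All rules of [S] are TGDs, so the fact sets only grow. *)
have H_mono i j : i <= j -> {subset H i <= H j}.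
  move=> /subnK<-; elim: (j - i) => // k IH a /IH aH; rewrite addSn.
  have [r [s [/S_tgd[t ->] _ ->]]] := H_step (k + i); exact: sub_add_head.
suff /(termS G0 G0_facts)[] : chase_sequence le S G0 None H by [].
split; first by rewrite H0 x0.
  by move=> i _; exact: H_step.
move=> i r s _ rS; have [t et] := S_tgd r rS; rewrite {r}et in rS * => -[/= sb _].
have [|n i_n sat] := fair i t s rS.
  by rewrite -Hphi; exact: instance_sub (H_mono _ _ (phi_ge i)) sb.
(* The successor makes the index strictly larger than [i], since [i <= n < phi n.+1]; growth of the
   fact sets preserves satisfaction up to there. *)
exists (phi n.+1); split=> //; first exact: leq_trans (phi_ge n.+1).
case=> _; apply; apply: satisfied_sub sat => a /G_sub.
by rewrite Hphi.
Qed.
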